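(* Let $(V_i)_{i\ge2}$ be i.i.d. random variables with law $\mathcal{L}$ on $[0,1]$. For each $n$ let $K=K^{(n)}$ be the random birth-and-death Markov kernel on $\{1,\dots,n\}$ given by $$K_{1,2}=1,\quad K_{n,n-1}=1,\quad K_{i,i+1}=V_i,\quad K_{i,i-1}=1-V_i\quad(2\le i\le n-1),$$ all other entries being zero, with eigenvalues $-1=\lambda_n(K)\le\cdots\le\lambda_1(K)=1$. Let $\mu$ be the symmetric, non-random limiting spectral distribution of $K$ on $[-1,+1]$ (the almost sure weak limit of $\frac1n\sum_{k=1}^n\delta_{\lambda_k(K)}$ as $n\to\infty$), and let $[-\alpha_\mu,+\alpha_\mu]$ be the convex hull of the support of $\mu$. If $\mathcal{L}$ has a positive density at $1/2$, then $\alpha_\mu=1$. Consequently, almost surely, $$\lambda_2(K)=-\lambda_{n-1}(K)=1+o(1)\qquad(n\to\infty).$$ On the other hand, if $\mathcal{L}$ is supported on $[0,t]$ with $0<t<1/2$ or on $[t,1]$ with $1/2<t<1$, then almost surely $\limsup_{n\to\infty}\lambda_2(K)<1$, and therefore $\alpha_\mu<1$.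
   Context: The eigenvalues of the tridiagonal stochastic matrix $K$ (counted with algebraic multiplicity) are real and lie in $[-1,1]$, and the spectrum is symmetric about $0$. The measure $\mu$ exists and is the probability measure on $[-1,1]$ whose odd moments vanish and whose even moments are, for $k\ge1$, $\int x^{2k}\,\mu(dx)=\sum_{\gamma\in D_k}\prod_{i\in\mathbb{Z}}\mathbb{E}\left(V^{N_\gamma(i)}(1-V)^{N_\gamma(i-1)}\right)$, where $V$ has law $\mathcal{L}$, $D_k$ is the set of $\mathbb{Z}$-valued paths $\gamma=(\gamma_0,\dots,\gamma_{2k})$ with $\gamma_0=\gamma_{2k}=0$ and $|\gamma_\ell-\gamma_{\ell+1}|=1$ for $0\le\ell\le2k-1$, and $N_\gamma(i)$ is the number of $0\le\ell\le 2k-1$ with $(\gamma_\ell,\gamma_{\ell+1})=(i,i+1)$ (with $0^0=1$). ''$\mathcal{L}$ has a positive density at $1/2$'' is understood in the following sense: there exist $C>0$ and $0<t_0<1/2$ such that $\mathcal{L}([1/2-t,1/2+t])\ge Ct$ for all $0<t<t_0$. *)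

(* Defs.v *)
From HB Require Import structures.
From mathcomp Require Import all_boot all_order all_algebra.
From mathcomp Require Import finmap.
From mathcomp Require Import all_classical all_reals all_analysis.

Set Implicit Arguments.
Unset Strict Implicit.
Unset Printing Implicit Defensive.

Import Order.TTheory GRing.Theory Num.Theory.
Import numFieldNormedType.Exports.

Local Open Scope classical_set_scope.
Local Open Scope ring_scope.

(** Rows and columns are numbered from 0 in ['I_n] and from 1 in the
    mathematical text: [p] and [q] are the 1-based indices.  The boundary rows
    are tested first, so only [v 2, ..., v n.-1] are used.  [bd_kernel] is meant
    for [2 <= n]; it is the zero matrix for [n <= 1]. *)
Definition bd_kernel (R : realType) (v : nat -> R) (n : nat) : 'M[R]_n :=
  \matrix_(i < n, j < n)
    let p := i.+1 in let q := j.+1 in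
    if q == p.+1 then (if p == 1%N then 1 else v p)
    else if p == q.+1 then (if p == n then 1 else 1 - v p)
    else 0.

(** The eigenvalues of [A] with algebraic multiplicity, in nonincreasing order.
    The list is unique when it exists, that is, when the characteristic
    polynomial splits over [R]; the default value [::] is taken otherwise. *)
Definition spectrum (R : realType) (n : nat) (A : 'M[R]_n) : seq R :=
  xget [::] [set s : seq R |
    sorted >=%R s /\ char_poly A = \prod_(x <- s) ('X - x%:P)].

(** [eigval A k] is the [k]-th largest eigenvalue, [k] starting at 1. *)
Definition eigval (R : realType) (n : nat) (A : 'M[R]_n) (k : nat) : R :=
  nth 0 (spectrum A) k.-1.

Definition empirical_spectral (R : realType) (n : nat) (A : 'M[R]_n) :
    {measure set (measurableTypeR R) -> \bar R} :=
  mscale (n%:R^-1)%:nng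
    (msum (fun k : nat => \d_(eigval A k.+1 : measurableTypeR R)) n).

Definition weakly_converges (R : realType)
    (m : nat -> {measure set (measurableTypeR R) -> \bar R})
    (mu : {measure set (measurableTypeR R) -> \bar R}) : Prop :=
  forall f : R -> R, continuous f -> bounded_fun f ->
    (fun n => \int[m n]_x f x) @ \oo --> \int[mu]_x f x.

Definition limiting_spectral_distribution (R : realType) (d : measure_display)
    (T : measurableType d) (P : probability T R) (V : nat -> {RV P >-> R})
    (mu : probability (measurableTypeR R) R) : Prop :=
  {ae P, forall w, weakly_converges
    (fun n => empirical_spectral (bd_kernel (fun i => V i w) n)) mu}.

Definition msupport (R : realType)
    (mu : {measure set (measurableTypeR R) -> \bar R}) : set R :=
  [set x | forall e : R, 0 < e -> (0 < mu (ball x e))%E].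

Definition convex_hull (R : realType) (A : set R) : set R :=
  smallest (@convex_set R R^o) A.

Definition is_edge (R : realType)
    (mu : {measure set (measurableTypeR R) -> \bar R}) (alpha : R) : Prop :=
  convex_hull (msupport mu) = [set` `[- alpha, alpha]].

Definition mutually_independent (R : realType) (d : measure_display)
    (T : measurableType d) (P : probability T R) (I : set nat)
    (V : nat -> {RV P >-> R}) : Prop :=
  forall (J : {fset nat}) (B : nat -> set (measurableTypeR R)),
    [set` J] `<=` I -> (forall i, measurable (B i)) ->
    P (\bigcap_(i in [set` J]) (V i @^-1` B i)) =
    (\prod_(i <- J) P (V i @^-1` B i))%E.

Definition has_law (R : realType) (d : measure_display)
    (T : measurableType d) (P : probability T R) (X : {RV P >-> R})
    (L : probability (measurableTypeR R) R) : Prop :=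
  forall B : set (measurableTypeR R), measurable B -> distribution P X B = L B.

Definition positive_density_at_half (R : realType)
    (L : probability (measurableTypeR R) R) : Prop :=
  exists C t0 : R, [/\ 0 < C, 0 < t0 < 1 / 2 &
    forall t : R, 0 < t < t0 ->
      ((C * t)%:E <= L [set` `[(1 / 2 - t)%R, (1 / 2 + t)%R]])%E].

(* Main.v *)
Require Import Defs.
From HB Require Import structures.
From mathcomp Require Import all_boot all_order all_algebra.
From mathcomp Require Import finmap complex ring lra zify.
From mathcomp Require Import all_classical all_reals all_analysis.
From mathcomp Require Import measurable_realfun.

Set Implicit Arguments.
Unset Strict Implicit.
Unset Printing Implicit Defensive.

Import Order.TTheory GRing.Theory Num.Theory.
Import numFieldNormedType.Exports.

Local Open Scope classical_set_scope.
Local Open Scope ring_scope.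

(** The spectrum of a birth-and-death kernel [K] is that of a symmetric matrix.
    The determinant of a tridiagonal matrix depends on its off-diagonal entries
    only through the products of mirror entries, so [K] has the characteristic
    polynomial of the Jacobi matrix [J] with zero diagonal and off-diagonal
    entries sqrt (K_{i,i+1} K_{i+1,i}), and also that of [-K], whence a spectrum
    symmetric about 0 ([spectrum_rev_opp]).  The eigenvalues of [J] are located
    by the Courant-Fischer principle ([count_eigen_ge]): if the quadratic form of
    [J] is at least [c] times the squared norm on a space of dimension [r], then
    [r] eigenvalues are at least [c].

    Mass near 1/2.  On a run of [m] consecutive sites where the environment is
    within [e] of 1/2, the entries of [J] are at least 1/2 - e, and the indicator
    of the run has Rayleigh quotient at least (1 - 2e)(1 - 1/m), which is as
    close to 1 as desired.  Runs separated by a gap give orthogonal test vectors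
    that [J] does not couple, so there are as many eigenvalues above this level
    as such runs ([count_near_half_runs]).  By independence there are almost
    surely infinitely many runs ([ae_frequently_block]); two of them bring
    lambda_2 close to 1.  Moreover the expected proportion of good blocks is a
    positive constant.  If the limit [mu] gave no mass to some neighbourhood of
    1, this proportion would tend to 0 almost surely, hence in mean by dominated
    convergence: a contradiction ([block_freq_Ncvg0], [msupport1]).

    Drift.  If the environment stays on one side of 1/2, the chain drifts towards
    one end.  Once the site at that end is deleted, the function [i |-> r ^ i],
    for a suitable [r], is contracted by the chain: weighted AM-GM bounds the
    form of [J] below by [- rho] on the vectors vanishing at that site, with
    rho = 1/2 + 2t(1 - t) < 1 ([jacobi_qform_ge_drop], [count_ge_gap]).
    This space has codimension 1, so all eigenvalues but one are at least
    [- rho], and by symmetry lambda_2 <= rho.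

    Edges of the limit.  A point is in the support of [mu] exactly when every
    bump function around it has positive integral ([msupport_bumpP]), and these
    integrals are limits of averages over the finite spectra.  The support
    inherits their symmetry, and stays in [-a, a] as soon as at most two
    eigenvalues of each matrix are outside.  The convex hull of a nonempty
    bounded symmetric support is the interval between minus and plus its
    supremum ([is_edge_exists]). *)

(** * Tridiagonal determinants *)

Definition tridiag (R : nzRingType) (d u l : nat -> R) (n : nat) : 'M[R]_n :=
  \matrix_(i < n, j < n)
    if j == i.+1 :> nat then u i
    else if i == j.+1 :> nat then l j
    else if i == j :> nat then d i else 0.

(** Laplace expansion along the first row, then along the first column of the
    only minor that is not tridiagonal. *)
Lemma det_tridiag (R : comNzRingType) (d u l : nat -> R) (n : nat) :
  \det (tridiag d u l n.+2) =
  d 0%N * \det (tridiag (d \o succn) (u \o succn) (l \o succn) n.+1)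
  - u 0%N * l 0%N *
    \det (tridiag (d \o succn \o succn) (u \o succn \o succn)
                  (l \o succn \o succn) n).
Proof.
rewrite (expand_det_row _ ord0) big_ord_recl big_ord_recl big1 ?addr0; last first.
  by move=> i _; rewrite !mxE /= mul0r.
rewrite !mxE /=; congr (_ + _).
  rewrite /cofactor /= addn0 expr0 mul1r; congr (_ * \det _).
  by apply/matrixP => i j; rewrite !mxE /=.
rewrite -mulNr -mulrN -mulrA; congr (_ * _).
rewrite /cofactor expr1 mulN1r mulNr; congr (- _).
rewrite (expand_det_col _ ord0) big_ord_recl big1 ?addr0; last first.
  by move=> i _; rewrite !mxE /= mul0r.
rewrite !mxE /=; congr (_ * _).
rewrite /cofactor /= addn0 expr0 mul1r; congr (\det _).
by apply/matrixP => i j; rewrite !mxE /=.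
Qed.

(** The recurrence [det_tridiag] sees [u] and [l] only through [u j * l j]. *)
Lemma eq_det_tridiag (R : comNzRingType) (n : nat) (d u l u' l' : nat -> R) :
  (forall j, (j.+1 < n)%N -> u j * l j = u' j * l' j) ->
  \det (tridiag d u l n) = \det (tridiag d u' l' n).
Proof.
have [m] := ubnP n; elim: m => // m IH in n d u l u' l' *.
case: n => [|[|n]] nm eqp; first by rewrite !det_mx00.
  by rewrite !det_mx11 !mxE.
rewrite !det_tridiag eqp //; congr (_ * _ - _ * _); apply: IH => //.
- by move=> j jn; apply: eqp.
- by move: nm; rewrite !ltnS; apply: ltnW.
- by move=> j jn; apply: eqp.
Qed.

Lemma char_poly_tridiag (R : comNzRingType) (n : nat) (d u l : nat -> R) :
  char_poly (tridiag d u l n) =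
  \det (tridiag (fun i => 'X - (d i)%:P) (fun i => - (u i)%:P)
                (fun i => - (l i)%:P) n).
Proof.
rewrite /char_poly; congr (\det _); apply/matrixP => i j; rewrite !mxE.
rewrite -val_eqE /=.
case: (eqVneq (j : nat) i.+1) => [->|_]; first by rewrite ltn_eqF // sub0r.
case: (eqVneq (i : nat) j.+1) => [->|_]; first by rewrite gtn_eqF // sub0r.
by case: eqVneq => // _; rewrite ?mulr1n // ?polyC0 subr0.
Qed.

Lemma eq_char_poly_tridiag (R : comNzRingType) (n : nat)
    (d u l u' l' : nat -> R) :
  (forall j, (j.+1 < n)%N -> u j * l j = u' j * l' j) ->
  char_poly (tridiag d u l n) = char_poly (tridiag d u' l' n).
Proof.
move=> eqp; rewrite !char_poly_tridiag; apply: eq_det_tridiag => j jn.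
by rewrite !mulrNN -!polyCM eqp.
Qed.

(** [X + A] is minus [X - A] evaluated at [-X]; the two signs [(-1) ^ n], from the
    determinant and from the [n] linear factors, cancel. *)
Lemma char_poly_opp (R : comNzRingType) (n : nat) (A : 'M[R]_n) (s : seq R) :
  char_poly A = \prod_(x <- s) ('X - x%:P) ->
  char_poly (- A) = \prod_(x <- [seq - x | x <- s]) ('X - x%:P).
Proof.
move=> chA.
have szs : size s = n.
  by apply: succn_inj; rewrite -(size_char_poly A) chA size_prod_XsubC.
have -> : char_poly (- A) = (-1) ^+ n * (char_poly A \Po - 'X).
  rewrite /char_poly -det_map_mx -detZ; congr (\det _).
  apply/matrixP => i j; rewrite !mxE /= comp_polyB comp_polyC.
  rewrite [X in _ = - 1 * (X - _)]raddfMn /= .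
  rewrite comp_polyX polyCN; case: (i == j); rewrite ?mulr1n ?mulr0n; ring.
rewrite chA rmorph_prod /= big_map -szs.
elim: s {chA szs} => [|x s IH]; first by rewrite !big_nil mulr1.
rewrite !big_cons -IH exprS comp_polyB comp_polyX comp_polyC polyCN; ring.
Qed.

(** * Quadratic forms of real symmetric matrices *)

Definition sqnorm (R : comNzRingType) (n : nat) (x : 'rV[R]_n) : R :=
  (x *m x^T) 0 0.
Definition qform (R : comNzRingType) (n : nat) (A : 'M[R]_n) (x : 'rV[R]_n) : R :=
  (x *m A *m x^T) 0 0.

Lemma char_poly_similar (R : comUnitRingType) n (P A : 'M[R]_n) :
  P \in unitmx -> char_poly (invmx P *m A *m P) = char_poly A.
Proof.
move=> Pu; rewrite /char_poly.
have PVP : map_mx polyC (invmx P) *m map_mx polyC P = 1%:M.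
  by rewrite -map_mxM mulVmx // map_mx1.
have -> : char_poly_mx (invmx P *m A *m P) =
  map_mx polyC (invmx P) *m char_poly_mx A *m map_mx polyC P.
  rewrite /char_poly_mx mulmxBr mulmxBl !map_mxM mul_mx_scalar -scalemxAl.
  by rewrite PVP scalemx1.
by rewrite !det_mulmx mulrAC -det_mulmx PVP det1 mul1r.
Qed.

(** A diagonal matrix is a sum of multiples of [delta_mx i i], one for each
    nonzero entry. *)
Lemma rank_diag_le (F : fieldType) n (d : 'rV[F]_n) :
  (\rank (diag_mx d) <= #|[pred i | (d 0 i != 0)%R]|)%N.
Proof.
have -> : diag_mx d = \sum_(i | d 0 i != 0) d 0 i *: delta_mx i i.
  apply/matrixP => i j; rewrite !mxE summxE.
  under eq_bigr do rewrite !mxE.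
  case: (eqVneq (d 0 i) 0) => [d0|dn].
    rewrite d0 mul0rn big1 // => k dk; case: eqP => [ik|_ /=]; last by rewrite mulr0.
    by rewrite -ik d0 eqxx in dk.
  rewrite (bigD1 i) //= eqxx big1 => [|k /andP[_ ki]].
    by rewrite addr0 /= eq_sym mulr_natr.
  by rewrite eq_sym (negbTE ki) mulr0.
rewrite -sum1_card.
apply: (big_ind2 (fun (A : 'M[F]_n) k => (\rank A <= k)%N)) => [|A k B l Ak Bl|i _].
- by rewrite mxrank0.
- exact: leq_trans (mxrank_add _ _) (leq_add Ak Bl).
by rewrite (leq_trans (mxrank_scale _ _)) // mxrank_delta.
Qed.

Section RealSymmetric.
Local Open Scope sesquilinear_scope.

(** Real quadratic forms are compared with Hermitian ones, to which the complex
    spectral theorem applies: writing x = a + ib, the cross terms cancel since [J]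
    is symmetric. *)
Lemma complexify_qform (R : rcfType) n (J : 'M[R]_n) (x : 'rV[R[i]]_n) :
  J^T = J ->
  (x *m map_mx (real_complex R) J *m x ^t*) 0 0 =
  real_complex R (qform J (map_mx (@complex.Re R) x) + qform J (map_mx (@complex.Im R) x)).
Proof.
move=> Js; set p := map_mx _ x; set q := map_mx _ x.
have -> : x = map_mx (real_complex R) p + 'i%R *: map_mx (real_complex R) q.
  by apply/matrixP => i j; rewrite !mxE -complexiE -complexE.
have -> : (map_mx (real_complex R) p + 'i%R *: map_mx (real_complex R) q) ^t* =
   map_mx (real_complex R) p^T - 'i%R *: map_mx (real_complex R) q^T.
  apply/matrixP => i j; rewrite !mxE rmorphD rmorphM /= conjCi mulNr.
  by congr (_ - _ * _); apply/CrealP; rewrite complex_real.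
rewrite !mulmxDl !mulmxBr -!scalemxAl -!scalemxAr -!map_mxM !scalerA.
have -> : p *m J *m q^T = q *m J *m p^T.
  by rewrite -[LHS]trmxK [(p *m _ *m _)^T]mx11_scalar tr_scalar_mx -mx11_scalar
             !trmx_mul !trmxK Js mulmxA.
by rewrite -expr2 sqrCi scaleN1r /qform !mxE rmorphD /=; ring.
Qed.

Lemma sqnorm_qform (R : comNzRingType) n (x : 'rV[R]_n) :
  sqnorm x = qform 1%:M x.
Proof. by rewrite /qform mulmx1. Qed.

Lemma mulmx_conj_cancel (R : nzRingType) m n p (y : 'M[R]_(m, n))
    (U U1 U2 D : 'M[R]_n) (z : 'M[R]_(n, p)) :
  U *m U1 = 1%:M -> U *m U2 = 1%:M ->
  y *m U *m (U1 *m D *m U) *m (U2 *m z) = y *m D *m z.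
Proof.
move=> e1 e2; rewrite !mulmxA -(mulmxA y) e1 mulmx1.
by rewrite -(mulmxA _ U U2) e2 mulmx1.
Qed.

(** Courant-Fischer lower bound.  Diagonalize [J] over [R[i]] in a unitary basis.
    If fewer than [r] eigenvalues were at least [c], a dimension count would give
    a nonzero vector in the row space of [A] with no component along the
    corresponding eigenvectors; its Rayleigh quotient would be below [c], and
    this passes to its real or to its imaginary part, which both lie in the row
    space of [A] over [R]. *)
Lemma count_eigen_ge (R : rcfType) n (J : 'M[R]_n) : J^T = J ->
  exists2 s : seq R, char_poly J = \prod_(x <- s) ('X - x%:P) &
    forall r (A : 'M[R]_(r, n)) (c : R), row_free A ->
      (forall x : 'rV[R]_r, c * sqnorm (x *m A) <= qform J (x *m A)) ->
      (r <= count (fun x => (c <= x)%R) s)%N.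
Proof.
move=> Js; pose JC := map_mx (real_complex R) J.
have JCh : JC \is hermsymmx.
  apply/is_hermitianmxP; rewrite expr0 scale1r; apply/matrixP => i j.
  by rewrite !mxE -[in LHS]Js mxE; apply/esym/CrealP; rewrite complex_real.
have /orthomx_spectralP := hermitian_normalmx JCh.
have := hermitian_spectral_diag_real JCh; have := spectral_unitarymx JC.
move: (spectralmx JC) (spectral_diag JC) => U d Uu dreal JCE.
have dE i : d 0 i = real_complex R (complex.Re (d 0 i)).
  by rewrite RRe_real //; apply: (mxOverP dreal).
exists [seq complex.Re (d 0 i) | i <- enum 'I_n].
  apply: (map_inj_poly (@complexI R) (rmorph0 _)).
  rewrite map_char_poly -/JC JCE char_poly_similar ?unitarymx_unit //.
  rewrite char_poly_trig ?diag_mx_is_trig // rmorph_prod big_map big_enum /=.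
  by apply: eq_bigr => i _; rewrite !mxE eqxx mulr1n map_polyXsubC /= -dE.
move=> r A c Afree Apos; rewrite leqNgt; apply/negP.
rewrite count_map -sum1_count big_enum_cond /= => kr.
(* [e] selects the eigenvectors with eigenvalue at least [c]. *)
pose e : 'rV[R[i]]_n := \row_i (c <= complex.Re (d 0 i))%R%:R.
pose AC := map_mx (real_complex R) A.
have kE : (\rank (diag_mx e) < r)%N.
  apply: leq_ltn_trans (rank_diag_le _) _; rewrite -sum1_card.
  rewrite (eq_bigl (fun i => c <= complex.Re (d 0 i))%R) // => i.
  by rewrite !inE mxE pnatr_eq0 eqb0 negbK.
have : \rank (AC *m U ^t* *m diag_mx e) != r.
  by rewrite neq_ltn (leq_ltn_trans (mxrankM_maxr _ _) kE).
rewrite -/(row_free _) -kermx_eq0 => /rowV0Pn[x /sub_kermxP xM xn0].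
pose y := x *m AC *m U ^t*.
have yU : y *m U = x *m AC by rewrite mulmxKtV.
have y_hi i : c <= complex.Re (d 0 i) -> y 0 i = 0.
  move=> ci; move/matrixP/(_ 0 i): xM.
  by rewrite !mulmxA mul_mx_diag !mxE ci mulr1.
have yn0 : y != 0.
  apply: contra_neq xn0 => y0; move: yU; rewrite y0 mul0mx => /esym/eqP.
  by rewrite mulmx_free_eq0 ?row_free_map // => /eqP.
pose d' : 'rV[R]_n := map_mx (@complex.Re R) d.
have dE' : diag_mx d = map_mx (real_complex R) (diag_mx d').
  by rewrite map_diag_mx; congr diag_mx; apply/rowP => i; rewrite !mxE; exact: dE.
have ReM : map_mx (@complex.Re R) (x *m AC) = map_mx (@complex.Re R) x *m A.
  apply/rowP => j; rewrite !mxE.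
  rewrite (big_morph (@complex.Re R) (id1 := 0) (op1 := +%R)) //; last by case=> ? ? [].
  by apply: eq_bigr => k _; rewrite !mxE; case: (x 0 k) => a b /=; rewrite mulr0 subr0.
have ImM : map_mx (@complex.Im R) (x *m AC) = map_mx (@complex.Im R) x *m A.
  apply/rowP => j; rewrite !mxE.
  rewrite (big_morph (@complex.Im R) (id1 := 0) (op1 := +%R)) //; last by case=> ? ? [].
  by apply: eq_bigr => k _; rewrite !mxE; case: (x 0 k) => a b /=; rewrite mulr0 add0r.
have transfer (F G : 'M[R]_n) : F^T = F -> G^T = G ->
    map_mx (real_complex R) F = invmx U *m map_mx (real_complex R) G *m U ->
    qform F (map_mx (@complex.Re R) x *m A) + qform F (map_mx (@complex.Im R) x *m A) =
    qform G (map_mx (@complex.Re R) y) + qform G (map_mx (@complex.Im R) y).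
  move=> Fs Gs FG; apply: (@complexI R).
  rewrite -ReM -ImM -!complexify_qform // FG -yU trmx_mul map_mxM /=.
  apply: (congr1 (fun M : 'M[R[i]]_1 => M 0 0)).
  apply: mulmx_conj_cancel; last exact/unitarymxP.
  by rewrite mulmxV // unitarymx_unit.
have eqJ := transfer J (diag_mx d') Js (tr_diag_mx _).
have {eqJ} := eqJ; rewrite -dE' -JCE => /(_ erefl) eqJ.
have := transfer 1%:M 1%:M (trmx1 _ _) (trmx1 _ _).
rewrite map_mx1 mulmx1 mulVmx ?unitarymx_unit // => /(_ erefl) eq1.
have := lerD (Apos (map_mx (@complex.Re R) x)) (Apos (map_mx (@complex.Im R) x)).
rewrite -mulrDr !sqnorm_qform eqJ eq1 /qform !mul_mx_diag !mulmx1.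
rewrite !mxE -!big_split /= mulr_sumr leNgt => /negP; apply.
clearbody y; pose N i := complex.Re (y 0 i) ^+ 2 + complex.Im (y 0 i) ^+ 2.
have [i yi] : exists i, y 0 i != 0.
  apply/existsP; apply: contraNT yn0 => /existsPn y0.
  by apply/eqP/rowP => i; move: (y0 i); rewrite mxE negbK => /eqP.
have Nge0 j : 0 <= N j by rewrite addr_ge0 ?sqr_ge0.
rewrite (eq_bigr (fun j => d' 0 j * N j)) => [|j _]; last first.
  by rewrite /N !mxE; ring.
rewrite [X in _ < X](eq_bigr (fun j => c * N j)) => [|j _]; last first.
  by rewrite /N !mxE; ring.
have yN j : (d' 0 j < c) || (y 0 j == 0).
  by rewrite mxE ltNge; case: leP => //= /y_hi ->.
rewrite (bigD1 i) //= [X in _ < X](bigD1 i) //=; apply: ltr_leD.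
  have := yN i; rewrite (negbTE yi) orbF => ?; rewrite ltr_pM2r //.
  rewrite lt_neqAle Nge0 andbT eq_sym paddr_eq0 ?sqr_ge0 // !sqrf_eq0.
  by apply: contraNN yi; case: (y 0 i) => a b /=; rewrite eq_complex.
apply: ler_sum => j _; case/orP: (yN j) => [/ltW dc|/eqP y0].
  exact: ler_wpM2r.
by rewrite /N y0 /= expr0n addr0 !mulr0.
Qed.

End RealSymmetric.

(** * Two bounds on the form of a Jacobi matrix *)

Definition jacobi (R : nzRingType) (w : nat -> R) n : 'M[R]_n :=
  tridiag (fun=> 0) w w n.

Lemma trmx_jacobi (R : nzRingType) (w : nat -> R) n : (jacobi w n)^T = jacobi w n.
Proof.
apply/matrixP => i j; rewrite !mxE.
case: (eqVneq (j : nat) i.+1) => [->|ji]; first by rewrite ltn_eqF // ltnW.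
by case: (eqVneq (i : nat) j.+1) => // _; rewrite !if_same.
Qed.

(** The row vector is extended to a function on [nat], so that the sums below can
    be shifted and telescoped without bound proofs on the indices. *)
Lemma sqnormE (R : comNzRingType) n (x : 'rV[R]_n) (X : nat -> R) :
  (forall i : 'I_n, x 0 i = X i) -> sqnorm x = \sum_(0 <= i < n) X i ^+ 2.
Proof.
by move=> xX; rewrite /sqnorm mxE big_mkord; apply: eq_bigr => i _; rewrite !mxE xX.
Qed.

Lemma qform_jacobi (R : comNzRingType) (w : nat -> R) n (x : 'rV[R]_n)
    (X : nat -> R) :
  (forall i : 'I_n, x 0 i = X i) ->
  qform (jacobi w n) x =
  \sum_(0 <= i < n) if (i.+1 < n)%N then 2 * (w i * X i * X i.+1) else 0.
Proof.
move=> xX; rewrite /qform mxE.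
pose e (i j : nat) : R := if j == i.+1 then w i * X i * X j else 0.
have sumE (i : 'I_n) :
    \sum_(j < n) e i j = if (i.+1 < n)%N then w i * X i * X i.+1 else 0.
  case: ltnP => [lt_i|ge_i]; last first.
    by apply: big1 => j _; rewrite /e ltn_eqF // (leq_trans _ ge_i).
  rewrite (bigD1 (Ordinal lt_i)) //= /e eqxx big1 ?addr0 // => j /negbTE.
  by rewrite -val_eqE /= => ->.
transitivity (\sum_(j < n) \sum_(i < n) (e i j + e j i)).
  apply: eq_bigr => j _; rewrite !mxE mulr_suml; apply: eq_bigr => i _.
  rewrite !mxE /e !xX.
  case: (eqVneq (j : nat) i.+1) => [->|ji].
    by rewrite ltn_eqF ?addr0 1?ltnW //; ring.
  by case: eqP => [->|_]; rewrite ?if_same; ring.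
under eq_bigr do rewrite big_split /=.
rewrite big_split /= exchange_big /= -big_split big_mkord; apply: eq_bigr => i _.
by rewrite /= !sumE; case: ifP => _; ring.
Qed.

(** Vertex sums regrouped by edges: [f i] is carried by the edge leaving [i] to
    the right and [g i] by the edge entering [i] from the left. *)
Lemma sum_vertices_edges (V : nmodType) (f g : nat -> V) n :
  g 0%N = 0 -> (forall i, (n <= i.+1)%N -> f i = 0) ->
  \sum_(0 <= i < n) (f i + g i) =
  \sum_(0 <= i < n) if (i.+1 < n)%N then f i + g i.+1 else 0.
Proof.
case: n => [|n] g0 fn; first by rewrite !big_geq.
rewrite big_split /= big_nat_recr //= fn // addr0 big_nat_recl // g0 add0r.
rewrite -big_split /= big_nat_recr //= ltnn addr0.
by apply: eq_big_nat => i /andP[_ lti]; rewrite ltnS lti.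
Qed.

(** Weighted AM-GM on each edge, with weights [r] and [1 / r]:
    2 sqrt (u l) x y >= - (u r x^2 + (l / r) y^2).  Summed over the edges, the
    coefficient of x_i^2 is that of [bd], which says that the function
    [i |-> r ^ i] is multiplied by at most [rho] by the chain with steps [u] up
    and [l] down, away from [k]. *)
Lemma jacobi_qform_ge_drop (R : rcfType) n (k : 'I_n) (u l : nat -> R) (r rho : R) :
  0 < r -> (forall j, (j.+1 < n)%N -> 0 <= u j /\ 0 <= l j) ->
  (forall i : nat, (i < n)%N -> i != k ->
     (if (i.+1 < n)%N then u i * r else 0) + (if i is j.+1 then l j / r else 0)
     <= rho) ->
  forall x : 'rV[R]_n, x 0 k = 0 ->
  - rho * sqnorm x <= qform (jacobi (fun j => Num.sqrt (u j * l j)) n) x.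
Proof.
move=> r0 ul0 bd x xk; pose X (i : nat) := oapp (x 0) 0 (insub i).
have xX i : x 0 i = X i by rewrite /X valK.
rewrite (sqnormE xX) (qform_jacobi _ xX).
pose out i := (if (i.+1 < n)%N then u i * r else 0) * X i ^+ 2.
pose inn i := (if i is j.+1 then l j / r else 0) * X i ^+ 2.
have edge i : (i.+1 < n)%N -> - (out i + inn i.+1) <=
    2 * (Num.sqrt (u i * l i) * X i * X i.+1).
  move=> lti; rewrite /out /inn lti; have [u0 l0] := ul0 _ lti.
  rewrite sqrtrM //.
  have := sqr_ge0 (Num.sqrt (u i) * Num.sqrt r * X i +
                   Num.sqrt (l i) / Num.sqrt r * X i.+1).
  have sr : Num.sqrt r != 0 by rewrite sqrtr_eq0 -ltNge.
  have -> : (Num.sqrt (u i) * Num.sqrt r * X i +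
                   Num.sqrt (l i) / Num.sqrt r * X i.+1) ^+ 2 =
    Num.sqrt (u i) ^+ 2 * Num.sqrt r ^+ 2 * X i ^+ 2 +
    Num.sqrt (l i) ^+ 2 / Num.sqrt r ^+ 2 * X i.+1 ^+ 2 +
    2 * (Num.sqrt (u i) * Num.sqrt (l i) * X i * X i.+1) by field.
  rewrite !sqr_sqrtr ?(ltW r0) // => h.
  by rewrite -subr_ge0 opprK; apply: etrans h; congr (_ <= _); ring.
apply: (@le_trans _ _ (- \sum_(0 <= i < n) (out i + inn i))).
  rewrite mulNr lerN2 mulr_sumr; apply: ler_sum_nat => i /andP[_ lti].
  rewrite /out /inn -mulrDl; have [->|ik] := eqVneq i k.
    by rewrite -xX xk expr0n !mulr0.
  by rewrite ler_wpM2r ?sqr_ge0 ?bd.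
rewrite (sum_vertices_edges (f := out) (g := inn)); last 2 first.
- by rewrite /inn mul0r.
- by move=> i; rewrite /out ltnNge => ->; rewrite mul0r.
rewrite -sumrN; apply: ler_sum_nat => i _.
by case: ifP => [/edge//|_]; rewrite oppr0.
Qed.

(** After a first site [0], the sites are cut into blocks of length [m.+1].  The last
    site of each block is left at [o]: this gap keeps the values of different
    blocks from being neighbours. *)
Definition plateau (T : Type) (o : T) (m : nat) (g : nat -> T) (i : nat) : T :=
  if i is i'.+1 then if (i' %% m.+1 < m)%N then g (i' %/ m.+1)%N else o else o.

(** Each plateau of height [g j] has [m] sites and [m - 1] edges, each edge
    contributing at least [b * g j ^+ 2].  The inequality is proved edge by edge:
    [F] is a potential whose increments are dominated by the excess carried by
    the edge, and which vanishes at the start. *)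
Lemma plateau_qform (R : realFieldType) (w g : nat -> R) (m n : nat) (b : R) :
  (0 < m)%N -> 0 <= b ->
  (forall j, g j != 0 -> (j.+1 * m.+1 < n)%N) ->
  (forall j k, g j != 0 -> (k.+1 < m)%N -> b <= 2 * w (j * m.+1 + k).+1) ->
  b * (1 - m%:R^-1) * \sum_(0 <= i < n) plateau 0 m g i ^+ 2 <=
  \sum_(0 <= i < n) if (i.+1 < n)%N
     then 2 * (w i * plateau 0 m g i * plateau 0 m g i.+1) else 0.
Proof.
move=> m0 b0 gn gw; set X := plateau 0 m g.
(* Along a plateau the excess is (b / m) g^2 at each edge; the last site has no
   edge and pays it all back. *)
pose F (i : nat) := if i is i'.+1 then
  if (i' %% m.+1 < m)%N then (i' %% m.+1)%:R / m%:R * b * g (i' %/ m.+1)%N ^+ 2 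
  else 0 else 0.
have mR0 : (m%:R : R) != 0 by rewrite pnatr_eq0 -lt0n.
have step i : F i.+1 - F i <=
    2 * (w i * X i * X i.+1) - b * (1 - m%:R^-1) * X i ^+ 2.
  case: i => [|i].
    by rewrite /X /= mod0n m0 !mul0r mulr0 mul0r expr0n !mulr0 subrr.
  rewrite /X /F /=; have kP := ltn_pmod i (ltn0Sn m).
  rewrite (divn_eq i m.+1); move: (i %/ m.+1)%N (i %% m.+1)%N kP => j k kP.
  rewrite -addnS !modnMDl !divnMDl // (modn_small kP) (divn_small kP) addn0.
  move: kP; rewrite ltnS leq_eqVlt => /predU1P[->|km].
    by rewrite ltnn modnn m0 expr0n !(mulr0, mul0r) subrr.
  rewrite km modn_small // divn_small // addn0.
  move: (km); rewrite leq_eqVlt => /predU1P[k1m|k1m].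
    rewrite [(k.+1 < m)%N]negbTE -?leqNgt ?k1m // !mulr0 !sub0r lerN2.
    rewrite ler_wpM2r ?sqr_ge0 //.
    have -> : 1 - m%:R^-1 = k%:R / m%:R :> R.
      by move: mR0; rewrite -k1m -natr1 => ?; field.
    by rewrite mulrC.
  rewrite k1m.
  have wg : b * g j ^+ 2 <= 2 * w (j * m.+1 + k.+1)%N * g j ^+ 2.
    have [->|gj] := eqVneq (g j) 0; first by rewrite expr0n !mulr0.
    by rewrite ler_wpM2r ?sqr_ge0 // addnS gw.
  rewrite -subr_ge0; move: wg; rewrite -subr_ge0 => wg; apply: etrans wg.
  by congr (_ <= _); rewrite -natr1; field.
have Fn : 0 <= F n.
  case: (n) => //= n'; case: ifP => // _.
  by rewrite mulr_ge0 ?sqr_ge0 // mulr_ge0 // divr_ge0 ?ler0n.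
rewrite -subr_ge0 mulr_sumr -sumrB; apply: le_trans Fn _.
have -> : F n = \sum_(0 <= i < n) (F i.+1 - F i).
  by rewrite telescope_sumr // /F subr0.
apply: ler_sum_nat => i /andP[_ lti]; case: ifPn => [_|]; first exact: step.
rewrite -leqNgt => ni; have -> : i = n.-1 by lia.
apply: (le_trans (step _)).
(* The last site has no edge to its right, but no plateau reaches site [n]. *)
suff -> : X n.-1.+1 = 0 by rewrite !mulr0.
rewrite prednK ?(leq_ltn_trans _ lti) // /X.
case: (n) gn => //= n' gn; case: ifP => // _; apply/eqP; apply: contraTT isT => /gn.
by rewrite ltnS leqNgt ltn_ceil.
Qed.

Definition plateau_mx (R : nzRingType) (m n : nat) (bs : seq nat) :
    'M[R]_(size bs, n) :=
  \matrix_(k < size bs, i < n) plateau 0 m (fun j => (j == nth 0%N bs k)%:R) i.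

Lemma plateau_mxE (R : nzRingType) m n bs (x : 'rV[R]_(size bs)) (i : 'I_n) :
  (x *m plateau_mx R m n bs) 0 i =
  plateau 0 m (fun j => \sum_k x 0 k * (j == nth 0%N bs k)%:R) i.
Proof.
rewrite mxE; case: i => [[|i] lti] /=.
  by apply: big1 => k _; rewrite mxE /= mulr0.
case: ifP => im; last by apply: big1 => k _; rewrite mxE /= im mulr0.
by apply: eq_bigr => k _; rewrite mxE /= im.
Qed.

Lemma plateau_mx_free (F : fieldType) m n bs :
  (0 < m)%N -> uniq bs -> (forall j, j \in bs -> (j * m.+1).+1 < n)%N ->
  row_free (plateau_mx F m n bs).
Proof.
move=> m0 ubs bsn; apply: inj_row_free => x x0; apply/rowP => k.
have lt_k : ((nth 0%N bs k * m.+1).+1 < n)%N by rewrite bsn ?mem_nth.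
have := plateau_mxE m x (Ordinal lt_k); rewrite x0 !mxE /= modnMl m0 mulnK //.
rewrite (bigD1 k) //= eqxx mulr1 big1 ?addr0 => [<-//|k' k'k].
by rewrite nth_uniq // eq_sym -val_eqE in k'k *; rewrite (negbTE k'k) mulr0.
Qed.

(** * Spectrum of a birth-and-death kernel *)

(** [up v i] and [down v n j] are the transition probabilities from the 0-based
    site [i] to [i.+1] and from [j.+1] to [j], boundary rows included. *)
Definition up (R : nzRingType) (v : nat -> R) (i : nat) : R :=
  if i is 0%N then 1 else v i.+1.
Definition down (R : nzRingType) (v : nat -> R) (n j : nat) : R :=
  if j.+2 == n then 1 else 1 - v j.+2.

Lemma bd_kernelE (R : realType) (v : nat -> R) n :
  bd_kernel v n = tridiag (fun=> 0) (up v) (down v n) n.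
Proof.
apply/matrixP => i j; rewrite !mxE /= !eqSS if_same.
case: (eqVneq (j : nat) i.+1) => _; first by rewrite /up; case: (nat_of_ord i).
by case: (eqVneq (i : nat) j.+1) => // ->; rewrite /down.
Qed.

Lemma nth_ge_count (R : realDomainType) (s : seq R) (c : R) (i : nat) :
  sorted >=%R s -> (i < count (fun x => (c <= x)%R) s)%N -> c <= nth 0 s i.
Proof.
move=> ss ic; rewrite leNgt; apply: contraTN ic => si; rewrite -leqNgt.
rewrite -(cat_take_drop i s) count_cat [X in (_ + X)%N](_ : _ = 0%N).
  by rewrite addn0 (leq_trans (count_size _ _)) // size_take_min geq_minl.
apply/eqP; rewrite -leqn0 leqNgt -has_count; apply/hasPn => x.
move=> /(nthP 0)[j]; rewrite size_drop nth_drop => js <-; rewrite -ltNge.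
apply: le_lt_trans si; apply: (sorted_leq_nth ge_trans ge_refl 0 ss);
  rewrite ?inE ?leq_addr //.
  by rewrite -subn_gt0 (leq_ltn_trans _ js).
by rewrite -ltn_subRL.
Qed.

(** Rows of l^1 norm at most 1: multiplication by [A] does not expand left vectors in
    the l^1 norm. *)
Lemma eigenvalue_le1 (R : realFieldType) n (A : 'M[R]_n) (a : R) :
  (forall i, \sum_j `|A i j| <= 1) -> eigenvalue A a -> `|a| <= 1.
Proof.
move=> A1 /eigenvalueP[x xA xn0].
have x_gt0 : 0 < \sum_i `|x 0 i|.
  rewrite lt_neqAle sumr_ge0 // andbT eq_sym psumr_eq0 //.
  apply: contraNN xn0 => /allP x0; apply/eqP/rowP => i.
  by have := x0 i (mem_index_enum i); rewrite /= normr_eq0 mxE => /eqP.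
rewrite -(ler_pM2r x_gt0) mul1r mulr_sumr.
apply: (@le_trans _ _ (\sum_j \sum_i `|x 0 i| * `|A i j|)).
  apply: ler_sum => j _; rewrite -normrM.
  have -> : a * x 0 j = (x *m A) 0 j by rewrite xA mxE.
  rewrite mxE; apply: le_trans (ler_norm_sum _ _ _) _.
  by apply: ler_sum => i _; rewrite normrM.
rewrite exchange_big; apply: ler_sum => i _ /=.
by rewrite -mulr_sumr ler_piMr.
Qed.

Lemma sqrt_mul_ge (R : rcfType) (h a b : R) :
  0 <= h -> h <= a -> h <= b -> h <= Num.sqrt (a * b).
Proof.
move=> h0 ha hb; rewrite -[leLHS]ger0_norm // -sqrtr_sqr ler_wsqrtr //.
by rewrite expr2 ler_pM.
Qed.

Section Spectrum.
Variables (R : realType) (v : nat -> R).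
Hypothesis v01 : forall p, (2 <= p)%N -> 0 <= v p <= 1.

Lemma up01 i : 0 <= up v i <= 1.
Proof. by case: i => [|i] /=; [rewrite ler01 lexx | exact: v01]. Qed.

Lemma down01 n j : 0 <= down v n j <= 1.
Proof.
rewrite /down; case: eqP => _; first by rewrite ler01 lexx.
by have /andP[? ?] := v01 (isT : 2 <= j.+2)%N; apply/andP; split; lra.
Qed.

Local Notation w n := (fun j => Num.sqrt (up v j * down v n j)).

Lemma char_poly_bd_kernel n : char_poly (bd_kernel v n) = char_poly (jacobi (w n) n).
Proof.
rewrite bd_kernelE; apply: eq_char_poly_tridiag => j _.
rewrite -expr2 sqr_sqrtr // mulr_ge0 //.
  by have /andP[] := up01 j.
by have /andP[] := down01 n j.
Qed.

(** The spectrum exists because [K] shares its characteristic polynomial with a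
    symmetric matrix, and it inherits the Courant-Fischer bound of that matrix. *)
Lemma bd_spectrumP n (s := spectrum (bd_kernel v n)) :
  [/\ sorted >=%R s, char_poly (bd_kernel v n) = \prod_(x <- s) ('X - x%:P) &
      forall r (A : 'M[R]_(r, n)) (c : R), row_free A ->
      (forall x : 'rV[R]_r, c * sqnorm (x *m A) <= qform (jacobi (w n) n) (x *m A)) ->
      (r <= count (fun x => (c <= x)%R) s)%N].
Proof.
have [s0 cs0 count0] := count_eigen_ge (trmx_jacobi (w n) n).
have [ss cs] : [set s : seq R | sorted >=%R s /\
   char_poly (bd_kernel v n) = \prod_(x <- s) ('X - x%:P)]%classic s.
  apply: xgetPex; exists (sort >=%R s0); split.
    by apply: sort_sorted => x y; exact: ge_total.
  rewrite char_poly_bd_kernel cs0; apply: perm_big.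
  by rewrite perm_sym perm_sort.
split=> // r A c Af Ac.
have /permP -> : perm_eq s s0; last exact: count0 Af Ac.
by apply: prod_XsubC_eq; rewrite -cs -cs0 char_poly_bd_kernel.
Qed.

Lemma size_spectrum n : size (spectrum (bd_kernel v n)) = n.
Proof.
have [_ cs _] := bd_spectrumP n.
by apply: succn_inj; rewrite -(size_char_poly (bd_kernel v n)) cs size_prod_XsubC.
Qed.

(** The off-diagonal products of [- K] are those of [K]. *)
Lemma spectrum_rev_opp n (s := spectrum (bd_kernel v n)) : s = rev (map -%R s).
Proof.
have [ss cs _] := bd_spectrumP n.
apply: (sorted_eq ge_trans ge_anti ss).
  rewrite rev_sorted sorted_map; apply: sub_sorted ss => x y /=.
  by rewrite lerN2.
rewrite perm_sym perm_rev; apply: prod_XsubC_eq.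
rewrite -(char_poly_opp cs) -/s -cs bd_kernelE.
have -> : - tridiag (fun=> 0) (up v) (down v n) n =
  tridiag (fun=> 0) (fun i => - up v i) (fun i => - down v n i) n.
  by apply/matrixP => i j; rewrite !mxE; do 3?case: ifP => _; rewrite ?oppr0.
by apply: eq_char_poly_tridiag => j _; rewrite mulrNN.
Qed.

Lemma spectrum_le1 n x : x \in spectrum (bd_kernel v n) -> `|x| <= 1.
Proof.
move=> xs; have [_ cs _] := bd_spectrumP n.
apply: (@eigenvalue_le1 _ _ (bd_kernel v n)); last first.
  by rewrite eigenvalue_root_char cs root_prod_XsubC.
move=> i; rewrite bd_kernelE.
have u0 := up01 i.
rewrite (eq_bigr (fun j : 'I_n => (if (j : nat) == i.+1 then up v i else 0) +
  (if (i : nat) == j.+1 then down v n j else 0))); last first.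
  move=> j _; rewrite mxE if_same; case: (eqVneq (j : nat) i.+1) => [->|_].
    by rewrite ltn_eqF // addr0 ger0_norm //; have /andP[] := u0.
  rewrite add0r; case: ifP => _; last by rewrite normr0.
  by rewrite ger0_norm //; have /andP[] := down01 n j.
rewrite big_split /= -!big_mkcond /= (big_ord1_eq _ (fun=> up v i)).
case: i u0 => [[|i] lti] u0 /=.
  rewrite big_pred0 // addr0; case: ifP => // _; exact: ler01.
rewrite (eq_bigl (fun j : 'I_n => (j : nat) == i)) => [|j]; last by rewrite eqSS eq_sym.
rewrite big_ord1_eq (ltn_trans (ltnSn i) lti) /down.
case: (eqVneq i.+2 n) => [->|ne]; first by rewrite ltnn add0r.
by rewrite ltn_neqAle ne lti addrC subrK.
Qed.

Lemma eigval_le1 n k : `|eigval (bd_kernel v n) k| <= 1.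
Proof.
rewrite /eigval; have [kn|kn] := ltnP k.-1 (size (spectrum (bd_kernel v n))).
  exact: spectrum_le1 (mem_nth _ kn).
by rewrite nth_default // normr0 ler01.
Qed.

Lemma eigval2_sym n : (2 <= n)%N ->
  eigval (bd_kernel v n) 2 = - eigval (bd_kernel v n) n.-1.
Proof.
move=> n2; rewrite /eigval {1}(spectrum_rev_opp n) nth_rev size_map size_spectrum //.
by rewrite (nth_map 0) ?size_spectrum //; [congr (- nth _ _ _); lia | lia].
Qed.

(** The test vectors are the rows of [plateau_mx]: the entries of the Jacobi matrix
    inside a plateau are geometric means of numbers that are at least 1/2 - e. *)
Lemma count_near_half_runs n m (bs : seq nat) (e : R) : (0 < m)%N -> e <= 2^-1 ->
  uniq bs -> (forall j, j \in bs -> (j.+1 * m.+1 < n)%N) ->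
  (forall j k, j \in bs -> (k < m)%N ->
     2^-1 - e <= v (j * m.+1 + k).+2 <= 2^-1 + e) ->
  (size bs <= count (fun x => ((1 - 2 * e) * (1 - m%:R^-1) <= x)%R)
                    (spectrum (bd_kernel v n)))%N.
Proof.
move=> m0 e0 ubs bsn vb; have [_ _ cnt] := bd_spectrumP n.
apply: (cnt _ (plateau_mx R m n bs)).
  by apply: plateau_mx_free => // j /bsn; apply: leq_ltn_trans; nia.
move=> x; have xE := @plateau_mxE R m n bs x.
rewrite (sqnormE xE) (qform_jacobi _ xE).
set g := (fun j => \sum_k _).
have gbs j : g j != 0 -> j \in bs.
  apply: contraNT => jbs; rewrite /g big1 // => k _.
  by case: eqP => [jk|_]; [rewrite jk mem_nth in jbs | rewrite mulr0].
apply: plateau_qform => //; first lra.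
  by move=> j /gbs /bsn.
move=> j k /gbs jb km; rewrite /= /down.
have /andP[a1 a2] := vb j k jb (ltnW km).
have /andP[b1 b2] := vb j k.+1 jb km.
rewrite addnS in b1 b2.
suff h : 2^-1 - e <= Num.sqrt (v (j * m.+1 + k).+2 *
   (if (j * m.+1 + k).+3 == n then 1 else 1 - v (j * m.+1 + k).+3)).
 by lra.
apply: sqrt_mul_ge; [lra|lra|].
by case: ifP => _; lra.
Qed.

(** The value of v r + (1 - v) / r at v = t, both for r = 1 / (2t), which suits
    t < 1/2, and for r = 2 (1 - t), which suits t > 1/2. *)
Definition gap_bound (t : R) : R := 2^-1 + 2 * t * (1 - t).

(** [v |-> v r + (1 - v) / r] is increasing for r > 1 and decreasing for r < 1,
    hence at most [gap_bound t] on the range of the environment.  The deleted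
    site is the reflecting end towards which the chain drifts: the first one when
    [v <= t < 1/2], the last one when [t <= v]. *)
Lemma count_ge_gap n (t : R) :
  (0 < t < 1 / 2 /\ (forall p, (2 <= p)%N -> v p <= t)) \/
  (1 / 2 < t < 1 /\ (forall p, (2 <= p)%N -> t <= v p)) ->
  (n.-1 <= count (fun x => (- gap_bound t <= x)%R) (spectrum (bd_kernel v n)))%N.
Proof.
case: n => [//|n] vt; have [_ _ cnt] := bd_spectrumP n.+1.
suff [r [k [r0 bd]]] : exists r, exists k : 'I_n.+1, 0 < r /\
  forall i : nat, (i < n.+1)%N -> i != k ->
     (if (i.+1 < n.+1)%N then up v i * r else 0) +
     (if i is j.+1 then down v n.+1 j / r else 0) <= gap_bound t.
  apply: (cnt _ (row' k 1%:M)).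
    (* The rows of [row' k 1%:M] span the vectors vanishing at [k]. *)
    apply: inj_row_free => x x0; apply/rowP => j; move/rowP/(_ (lift k j)): x0.
    rewrite !mxE (bigD1 j) //= big1 => [|j' j'j]; rewrite !mxE ?eqxx ?mulr1 ?addr0 //.
    by rewrite (inj_eq lift_inj) (negbTE j'j) mulr0.
  move=> x; apply: (@jacobi_qform_ge_drop _ _ k _ _ r) => //.
    move=> j _; have /andP[-> _] := up01 j.
    by have /andP[-> _] := down01 n.+1 j.
  by rewrite !mxE big1 // => j _; rewrite !mxE eq_sym (negbTE (neq_lift _ _)) mulr0.
case: vt => [[t01 vt]|[t01 vt]]; rewrite /gap_bound.
  have t0 : t != 0 by lra.
  exists (2 * t)^-1, ord0; split; first by rewrite invr_gt0; lra.
  case=> [//|i] lti _; rewrite invrK /down eqSS ltnS.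
  have /andP[v0 v1] := v01 (isT : 2 <= i.+2)%N; have vit := vt i.+2 isT.
  move: lti; rewrite ltnS leq_eqVlt => /predU1P[->|lti].
    by rewrite ltnn eqxx; nra.
  rewrite lti (ltn_eqF lti) /=.
  set q := (2 * t)^-1; have qt : t * q = 2^-1 by rewrite /q; field.
  have q1 : 1 <= q by rewrite /q invf_ge1; lra.
  have : 0 <= (t - v i.+2) * (q - 2 * t) by apply: mulr_ge0; lra.
  lra.
exists (2 * (1 - t)), ord_max; split; first lra.
move=> i lti /= ni.
have -> : (i.+1 < n.+1)%N by lia.
case: i ni lti => [|i] ni lti /=; first nra.
have /andP[v0 v1] := v01 (isT : 2 <= i.+2)%N; have vit := vt i.+2 isT.
have -> : down v n.+1 i = 1 - v i.+2.
  by rewrite /down eqSS ifF //; lia.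
have t1 : 1 - t != 0 by lra.
set q := (2 * (1 - t))^-1; have qt : (1 - t) * q = 2^-1 by rewrite /q; field.
have q1 : 1 <= q by rewrite /q invf_ge1; lra.
have : 0 <= (v i.+2 - t) * (q - 2 * (1 - t)) by apply: mulr_ge0; lra.
lra.
Qed.
End Spectrum.

(** * Support of a measure through bump functions *)

Section Bump.
Variable R : realType.
Implicit Types x e y : R.

(** A tent of height 1 over the ball of centre [x] and radius [e]. *)
Definition bump x e y : R := Num.max 0 (1 - `|y - x| / e).

Lemma bump_ge0 x e y : 0 <= bump x e y.
Proof. by rewrite le_max lexx. Qed.

Lemma bump_le1 x e y : 0 < e -> bump x e y <= 1.
Proof.
move=> e0; rewrite ge_max ler01 /= lerBlDr lerDl.
by rewrite divr_ge0 // ltW.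
Qed.

Lemma bump_out x e y : 0 < e -> e <= `|y - x| -> bump x e y = 0.
Proof. by move=> e0 exy; apply/max_idPl; rewrite subr_le0 ler_pdivlMr ?mul1r. Qed.

Lemma bump_half x e y : 0 < e -> `|y - x| <= e / 2 -> 2^-1 <= bump x e y.
Proof.
move=> e0 exy; rewrite le_max; apply/orP; right.
have : `|y - x| / e <= 2^-1 by rewrite ler_pdivrMr // mulrC.
lra.
Qed.

Lemma bumpN x e y : bump (- x) e y = bump x e (- y).
Proof. by rewrite /bump opprK -normrN opprD. Qed.

Lemma continuous_bump x e : continuous (bump x e).
Proof.
move=> y; apply: (@continuous_max _ _ (cst 0) (fun y => 1 - `|y - x| / e) y).
  exact: cvg_cst.
apply: cvgB; first exact: cvg_cst.
apply: cvgMr_tmp; apply: cvg_norm.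
by apply: cvgB; [exact: cvg_id|exact: cvg_cst].
Qed.

Lemma bounded_bump x e : 0 < e -> bounded_fun (bump x e).
Proof.
move=> e0; exists 1; split; first exact: num_real.
by move=> M M1 y _; rewrite /= ger0_norm ?bump_ge0 // (le_trans (bump_le1 _ _ e0)) // ltW.
Qed.

Lemma measurable_bump x e : measurable_fun setT (bump x e : measurableTypeR R -> R).
Proof. exact: continuous_measurable_fun (@continuous_bump x e). Qed.

Lemma measurable_EFin_bump x e :
  measurable_fun setT (fun y : measurableTypeR R => (bump x e y)%:E).
Proof. by apply: measurableT_comp => //; exact: measurable_bump. Qed.

Lemma le_integral_bump (mu : {measure set (measurableTypeR R) -> \bar R}) x e : 0 < e ->
  (\int[mu]_y (bump x e y)%:E <= mu (ball x e))%E.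
Proof.
move=> e0; rewrite -(setIT (ball x e)) -integral_indic //; last exact: measurable_ball.
apply: ge0_le_integral => //.
- by move=> y _; rewrite lee_fin bump_ge0.
- exact: measurable_EFin_bump.
- by apply: measurableT_comp => //; apply: measurable_indic; exact: measurable_ball.
- move=> y _; rewrite lee_fin indicE; have [xy|xy] := ltP `|x - y| e.
    by rewrite mem_set ?bump_le1.
  by rewrite bump_out ?ler0n // distrC.
Qed.

Lemma ge_integral_bump (mu : {measure set (measurableTypeR R) -> \bar R}) x e : 0 < e ->
  (2^-1%:E * mu (ball x (e / 2)) <= \int[mu]_y (bump x e y)%:E)%E.
Proof.
move=> e0; rewrite -integral_cst; last exact: measurable_ball.
apply: (@le_trans _ _ (\int[mu]_(y in ball x (e / 2)) (bump x e y)%:E)%E).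
  apply: ge0_le_integral => //.
  - exact: measurable_ball.
  - by move=> y _; rewrite lee_fin invr_ge0.
  - by apply: measurable_funTS; exact: measurable_EFin_bump.
  - move=> y; rewrite /ball /= => xy; rewrite lee_fin bump_half //.
    by rewrite distrC ltW.
apply: ge0_subset_integral => //; first exact: measurable_ball.
  exact: measurable_EFin_bump.
by move=> y _; rewrite lee_fin bump_ge0.
Qed.

End Bump.

Section Support.
Variable R : realType.

(** The bump lies between half the indicator of [ball x (e / 2)] and the indicator
    of [ball x e]. *)
Lemma msupport_bumpP (mu : probability (measurableTypeR R) R) (x : R) :
  msupport mu x <-> forall e : R, 0 < e -> 0 < \int[mu]_y bump x e y.
Proof.
have fin e : 0 < e -> (\int[mu]_y (bump x e y)%:E < +oo)%E.
  move=> e0; apply: le_lt_trans (le_integral_bump mu x e0) _.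
  by apply: le_lt_trans (probability_le1 mu _) (ltry _); exact: measurable_ball.
split=> [mux e e0|mux e e0].
  rewrite /Rintegral fine_gt0 // fin // andbT.
  apply: lt_le_trans (ge_integral_bump mu x e0).
  by rewrite mule_gt0 ?lte_fin ?invr_gt0 // mux // divr_gt0.
apply: lt_le_trans (le_integral_bump mu x e0).
rewrite lt0e integral_ge0 => [|y _]; last by rewrite lee_fin bump_ge0.
by rewrite andbT; apply: contraTneq (mux e e0); rewrite /Rintegral => ->; rewrite ltxx.
Qed.

(** Otherwise every point has a null ball; each segment is covered by finitely many
    of them, so the whole line would be null. *)
Lemma msupport_nonempty (mu : probability (measurableTypeR R) R) :
  msupport mu !=set0.
Proof.
apply/set0P/eqP => mu0.
have /choice[e e_prop] (x : R) : exists e : R, 0 < e /\ mu (ball x e) = 0%E.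
  have : ~ msupport mu x by rewrite mu0.
  move=> /existsNP[e] /not_implyP[e0 /negP].
  rewrite -leNgt => mue; exists e; split => //.
  by apply/eqP; rewrite eq_le mue measure_ge0.
have neg n : mu.-negligible (`[- n%:R, n%:R] : set (measurableTypeR R)).
  have := @segment_compact R (- n%:R) n%:R; rewrite compact_cover.
  case/(_ R setT (fun x => ball x (e x)))/(_ _ _).
  - by move=> x _; exact: ball_open.
  - by move=> x _; exists x => //; apply: ballxx; exact: (e_prop x).1.
  move=> D _ cov.
  apply: negligibleS; first exact: cov.
  rewrite /cover bigcup_fset.
  elim/big_ind : _ => //.
  - exact: negligible_set0.
  - by move=> A B; exact: negligibleU.
  - move=> x _; apply/negligibleP; first exact: measurable_ball.
    exact: (e_prop x).2.
have sT : mu.-negligible (setT : set (measurableTypeR R)).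
  apply: negligibleS (negligible_bigcup neg) => x _.
  exists (Num.truncn `|x|).+1 => //=.
  rewrite in_itv /= -ler_norml ltW //.
  by rewrite truncnS_gt.
have := etrans (esym (probability_setT mu)) (measure_negligible measurableT sT).
by move/eqP; rewrite onee_eq0.
Qed.

End Support.

(** * Convex hull of a symmetric support *)

Lemma convex_hull_sym (R : realType) (S : set R) (alpha : R) :
  0 <= alpha -> S alpha -> S (- alpha) -> S `<=` [set` `[- alpha, alpha]] ->
  convex_hull S = [set` `[- alpha, alpha]].
Proof.
move=> a0 Sa SNa Sle; apply/seteqP; split.
  apply: smallest_sub => // x y l; rewrite !inE /= !in_itv /= => xa ya.
  change (- alpha <= l%:num * x + (1 - l%:num) * y <= alpha).
  have l0 : 0 <= l%:num by []. 
  have l1 : l%:num <= 1 by [].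
  case/andP: xa => xa1 xa2; case/andP: ya => ya1 ya2.
  by apply/andP; split; nra.
move=> x /=; rewrite in_itv /= => /andP[x1 x2] C [cC SC].
have [a00|an0] := eqVneq alpha 0.
  have -> : x = alpha by lra.
  exact: SC.
have ap : 0 < alpha by rewrite lt_neqAle eq_sym an0.
pose l := (x + alpha) / (2 * alpha).
have l0 : 0 <= l by rewrite divr_ge0; lra.
have l1 : l <= 1 by rewrite ler_pdivrMr; lra.
have := cC alpha (- alpha) (Itv01 l0 l1).
rewrite !inE => /(_ (SC _ Sa) (SC _ SNa)); congr (C _).
change (l * alpha + (1 - l) * - alpha = x).
by rewrite /l; field.
Qed.

(** The supremum of the support belongs to it, because a ball around the supremum
    contains a smaller ball around some point of the support. *)
Lemma is_edge_exists (R : realType) (mu : probability (measurableTypeR R) R) (a : R) :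
  msupport mu `<=` [set` `[- a, a]] ->
  (forall x, msupport mu x -> msupport mu (- x)) ->
  exists alpha, [/\ is_edge mu alpha, alpha <= a & msupport mu alpha].
Proof.
move=> Sa Ssym; set S := msupport mu.
have [x0 Sx0] := msupport_nonempty mu.
have ubS : ubound S a by move=> x /Sa /=; rewrite in_itv /= => /andP[].
have hS : has_sup S by split; [exists x0 | exists a].
have Ssup : S (sup S).
  move=> e e0; have e2 : 0 < e / 2 by rewrite divr_gt0.
  have [y Sy ly] := sup_adherent e2 hS.
  apply: lt_le_trans (Sy _ e2) _.
  apply: le_measure; rewrite ?inE; [exact: measurable_ball|exact: measurable_ball|].
  have yS := sup_upper_bound hS Sy.
  move=> z; rewrite /ball /= !ltr_norml => /andP[z1 z2]; lra.
exists (sup S); split => //; last by apply: ge_sup; [exists x0|].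
have le_sup x : S x -> x <= sup S by exact: sup_upper_bound.
apply: convex_hull_sym => //.
- have := le_sup _ Sx0; have := le_sup _ (Ssym _ Sx0); lra.
- exact: Ssym.
- move=> x Sx /=; rewrite in_itv /= le_sup // andbT.
  by have := le_sup _ (Ssym _ Sx); lra.
Qed.

(** * Empirical spectral measures in one environment *)

Section Limit.
Variables (R : realType) (v : nat -> R).
Hypothesis v01 : forall p, (2 <= p)%N -> 0 <= v p <= 1.

Lemma Rintegral_empirical n (x e : R) :
  \int[empirical_spectral (bd_kernel v n)]_y bump x e y =
  n%:R^-1 * \sum_(y <- spectrum (bd_kernel v n)) bump x e y.
Proof.
rewrite /Rintegral ge0_integral_mscale //=; last 2 first.
- exact: measurable_EFin_bump.
- by move=> y _; rewrite lee_fin bump_ge0.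
rewrite ge0_integral_measure_sum //=; last 2 first.
- by move=> y _; rewrite lee_fin bump_ge0.
- exact: measurable_EFin_bump.
under eq_bigr do [rewrite integral_dirac //=; last exact: measurable_EFin_bump].
under eq_bigr do rewrite diracE in_setT mul1e.
rewrite sumEFin /=; congr (_ * _).
by rewrite (big_nth 0) big_mkord size_spectrum.
Qed.

Variable mu : probability (measurableTypeR R) R.
Hypothesis cvg_mu :
  weakly_converges (fun n => empirical_spectral (bd_kernel v n)) mu.

Lemma cvg_bump (x e : R) : 0 < e ->
  (fun n => n%:R^-1 * \sum_(y <- spectrum (bd_kernel v n)) bump x e y) @ \oo -->
  \int[mu]_y bump x e y.
Proof.
move=> e0; under eq_fun do rewrite -Rintegral_empirical.
by apply: cvg_mu; [exact: continuous_bump | exact: bounded_bump].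
Qed.

Lemma msupportN x : msupport mu x -> msupport mu (- x).
Proof.
move=> /msupport_bumpP Sx; apply/msupport_bumpP => e e0.
suff -> : \int[mu]_y bump (- x) e y = \int[mu]_y bump x e y by exact: Sx.
apply: cvg_unique (cvg_bump (x := - x) e0) _ => //.
rewrite (_ : (fun n => _) = fun n => n%:R^-1 *
   \sum_(y <- spectrum (bd_kernel v n)) bump x e y); first exact: cvg_bump.
apply/funext => n; rewrite [in RHS](perm_big (map -%R (spectrum (bd_kernel v n)))) /=.
  by rewrite big_map; congr (_ * _); apply: eq_bigr => y _; rewrite bumpN.
by rewrite {1}(spectrum_rev_opp v01 n) perm_rev.
Qed.

(** Away from [-a, a] the average of a bump over the spectrum is at most [2 / n]. *)
Lemma msupport_sub_itv (a : R) :
  (forall n, (count (fun y => ~~ (`|y| <= a)%R) (spectrum (bd_kernel v n)) <= 2)%N) ->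
  msupport mu `<=` [set` `[- a, a]].
Proof.
move=> out2 x /msupport_bumpP Sx /=; rewrite in_itv /= -ler_norml leNgt.
apply/negP => ax; pose e := `|x| - a; have e0 : 0 < e by rewrite subr_gt0.
have := Sx e e0; suff -> : \int[mu]_y bump x e y = 0 by rewrite ltxx.
apply: cvg_unique (cvg_bump (x := x) e0) _ => //.
apply: (@squeeze_cvgr _ _ _ _ (cst 0) (fun n => 2 * n%:R^-1)); last 2 first.
- exact: cvg_cst.
- rewrite -(mulr0 2); apply: cvgMl_tmp; rewrite -cvg_shiftS; exact: cvg_harmonic.
apply: nearW => n; rewrite mulr_ge0 ?invr_ge0 ?ler0n ?sumr_ge0 //= => [|y _];
  last exact: bump_ge0.
rewrite mulrC ler_wpM2r ?invr_ge0 ?ler0n //.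
apply: (@le_trans _ _ (\sum_(y <- spectrum (bd_kernel v n)) (~~ (`|y| <= a))%:R)).
  apply: ler_sum => y _; case: (lerP `|y| a) => /= ya; last exact: bump_le1.
  rewrite bump_out //; rewrite /e distrC.
  by apply: le_trans (lerB_dist _ _); rewrite lerB.
rewrite -natr_sum ler_nat; apply: leq_trans (out2 n).
rewrite -sum1_count [leqRHS]big_mkcond /=.
by apply: leq_sum => y _; case: (`|y| <= a).
Qed.

(** On eigenvalues, which are at most 1, the bump at 1 is at least 1/2 above
    1 - e / 2. *)
Lemma count_le_avg_bump n e : 0 < e ->
  2^-1 * ((count (fun y => (1 - e / 2 <= y)%R) (spectrum (bd_kernel v n)))%:R / n%:R) <=
  n%:R^-1 * \sum_(y <- spectrum (bd_kernel v n)) bump 1 e y.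
Proof.
move=> e0; rewrite mulrA mulrC ler_wpM2l ?invr_ge0 //.
rewrite -sum1_count natr_sum mulr_sumr big_mkcond !big_seq; apply: ler_sum => y ys.
case: ifP => [ye|_]; last exact: bump_ge0.
rewrite mulr1 bump_half // ler0_norm ?subr_le0; first lra.
by have := spectrum_le1 v01 ys; rewrite ler_norml => /andP[].
Qed.

End Limit.

(** * Runs of environment values in a given set *)

Section Events.
Context (R : realType) (d : measure_display) (T : measurableType d)
  (P : probability T R) (L : probability (measurableTypeR R) R)
  (V : nat -> {RV P >-> R}).
Hypothesis V_law : forall i : nat, (2 <= i)%N -> has_law (V i) L.
Hypothesis V_indep : mutually_independent [set i | (2 <= i)%N] V.

Lemma law_preimage (B : set (measurableTypeR R)) i : measurable B -> (2 <= i)%N ->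
  P (V i @^-1` B) = L B.
Proof. by move=> mB i2; rewrite -(V_law i2 mB). Qed.

Lemma measurable_preimage (B : set (measurableTypeR R)) i : measurable B ->
  measurable (V i @^-1` B).
Proof. by move=> mB; rewrite -[_ @^-1` _]setTI; apply: (measurable_funPT (V i)). Qed.

Lemma ae_law (B : set (measurableTypeR R)) : measurable B -> L B = 1%E ->
  {ae P, forall w, forall i, (2 <= i)%N -> B (V i w)}.
Proof.
move=> mB LB; apply: ae_foralln => i.
have [i2|i2] := leqP 2 i; last first.
  exact: aeW.
exists (~` (V i @^-1` B)); split.
- by apply: measurableC; exact: measurable_preimage.
- apply: etrans (probability_setC P (measurable_preimage i mB)) _.
  by rewrite law_preimage // LB subee.

- by move=> w /= /not_implyP[].
Qed.

Variable I : set (measurableTypeR R).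
Hypothesis mI : measurable I.

(** Events are indexed by lists of sites, so that the intersection of two of them
    is the event of the concatenated list and independence is an induction on
    lists. *)
Definition all_in (t : seq nat) : set T := [set w | forall i, i \in t -> I (V i w)].

Lemma all_in_bigcap t : all_in t = \bigcap_(i in [set` t]) (V i @^-1` I).
Proof. by apply/seteqP; split => w h i; exact: h. Qed.

Lemma measurable_all_in t : measurable (all_in t).
Proof.
rewrite all_in_bigcap bigcap_seq; apply: bigsetI_measurable => i _.
exact: measurable_preimage.
Qed.

Let p : R := fine (L I).

Let LIE : L I = p%:E.
Proof. by rewrite /p fineK // fin_num_measure. Qed.

(** Mutual independence with the same set [I] at every site. *)
Lemma probability_all_in t : uniq t -> all (leq 2) t ->
  P (all_in t) = (p ^+ size t)%:E.
Proof.
move=> ut t2; pose J : {fset nat} := [fset i in t]%fset.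
have -> : all_in t = \bigcap_(i in [set` J]) (V i @^-1` I).
  by apply/seteqP; split => w h i; move: (h i); rewrite /= !inE.
rewrite (V_indep (J := J) (B := fun=> I)) //; last first.
  by move=> i /=; rewrite !inE => /(allP t2).
have -> : (\prod_(i <- J) P (V i @^-1` I))%E = (\prod_(i <- t) P (V i @^-1` I))%E.
  apply: perm_big; apply: uniq_perm => //.
  by move=> i; rewrite !inE.
elim: t ut t2 {J} => [|i t IH] /=; first by rewrite big_nil.
move=> /andP[_ ut] /andP[i2 t2]; rewrite big_cons IH // law_preimage //.
by rewrite LIE exprS EFinM.
Qed.

Variable m : nat.
Hypothesis m0 : (0 < m)%N.

(** The 1-based sites of the plateau number [j] of [plateau]. *)
Definition block (j : nat) : seq nat := [seq (j * m.+1 + k).+2 | k <- iota 0 m].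

Lemma size_block j : size (block j) = m.
Proof. by rewrite size_map size_iota. Qed.

Lemma block_uniq j : uniq (block j).
Proof. by rewrite map_inj_uniq ?iota_uniq // => k l; lia. Qed.

Lemma block_ge2 j : all (leq 2) (block j).
Proof. by apply/allP => i /mapP[k _ ->]. Qed.

Lemma blockP j i : reflect (exists2 k, (k < m)%N & i = (j * m.+1 + k).+2) (i \in block j).
Proof.
apply: (iffP mapP) => [[k]|[k km ->]].
  by rewrite mem_iota => /andP[_ km] ->; exists k.
by exists k => //; rewrite mem_iota.
Qed.

Lemma block_inj j j' i : i \in block j -> i \in block j' -> j = j'.
Proof.
move=> /blockP[k km ->] /blockP[k' km' [] /(congr1 (fun x => x %/ m.+1)%N)].
by rewrite !divnMDl // !divn_small ?addn0 // ltnW // ltnS.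
Qed.

Lemma probability_all_in_block j : P (all_in (block j)) = (p ^+ m)%:E.
Proof. by rewrite probability_all_in ?block_uniq ?block_ge2 // size_block. Qed.

Definition no_block j0 M : set T :=
  [set w | forall j, (j0 <= j < j0 + M)%N -> ~ all_in (block j) w].

Lemma no_blockS j0 M :
  no_block j0 M.+1 = no_block j0 M `\` all_in (block (j0 + M)).
Proof.
apply/seteqP; split=> w; rewrite /no_block /=.
  move=> h; split; last by apply: h; rewrite leq_addr addnS ltnSn.
  by move=> j /andP[jl ju]; apply: h; rewrite jl addnS ltnW.
move=> [h1 h2] j; rewrite addnS ltnS => /andP[jl]; rewrite leq_eqVlt => /predU1P[->//|ju].
by apply: h1; rewrite jl.
Qed.

Lemma no_block0 j0 : no_block j0 0 = setT.
Proof.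
apply/seteqP; split=> w //= _ j; rewrite addn0.
by move=> /andP[jl /(leq_ltn_trans jl)]; rewrite ltnn.
Qed.

Lemma measurable_no_block j0 M : measurable (no_block j0 M).
Proof.
elim: M => [|M IH]; first by rewrite no_block0.
by rewrite no_blockS; apply: measurableD => //; exact: measurable_all_in.
Qed.

Lemma all_in_cat t t' : all_in (t ++ t') = all_in t `&` all_in t'.
Proof.
apply/seteqP; split=> w /=.
  by move=> h; split=> i it; apply: h; rewrite mem_cat it ?orbT.
by case=> h h' i; rewrite mem_cat => /orP[/h|/h'].
Qed.

(** The absence of blocks contained in [I] is not a product event, so it is removed one block
    at a time: P (N without E) = P N - P (N and E).  The extra list [t] is what
    makes the induction hypothesis apply to both terms. *)
Lemma probability_no_block j0 M t : uniq t -> all (leq 2) t ->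
  (forall j i, (j0 <= j < j0 + M)%N -> i \in block j -> i \notin t) ->
  P (no_block j0 M `&` all_in t) = ((1 - p ^+ m) ^+ M * p ^+ size t)%:E.
Proof.
elim: M t => [|M IH] t ut t2 tdisj.
  by rewrite no_block0 setTI probability_all_in // expr0 mul1r.
have tM j i : (j0 <= j < j0 + M)%N -> i \in block j -> i \notin t.
  by move=> /andP[jl ju]; apply: tdisj; rewrite jl addnS ltnW.
rewrite no_blockS setIDAC setIDA measureD; last 3 first.
- by apply: measurableI; [exact: measurable_no_block|exact: measurable_all_in].
- exact: measurable_all_in.
- rewrite (le_lt_trans (probability_le1 _ _)) ?ltry //.
  by apply: measurableI; [exact: measurable_no_block|exact: measurable_all_in].
rewrite -setIA -all_in_cat.
have e1 := IH t ut t2 tM.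
have := IH (t ++ block (j0 + M)); rewrite cat_uniq ut block_uniq andbT /= => /(_ _ _ _) e2.
apply: (etrans (congr2 (fun x y : \bar R => (x - y)%E) e1 (e2 _ _ _))).
- rewrite -all_predC; apply/allP => i ib /=; apply: tdisj ib.
  by rewrite leq_addr addnS ltnSn.
- by rewrite all_cat t2 block_ge2.
- move=> j i jj ij; rewrite mem_cat negb_or (tM j) //=.
  by apply: contraTN jj => /(block_inj ij) ->; rewrite ltnn andbF.
- rewrite size_cat size_block -EFinB; congr EFin; rewrite exprD exprS; ring.
Qed.

(** Call a block good if its values all lie in [I].  The absence of a good block
    among [M] consecutive ones has probability (1 - p^m)^M,
    which tends to 0. *)
Lemma ae_frequently_block : 0 < p ->
  {ae P, forall w, forall j0, exists2 j, (j0 <= j)%N & all_in (block j) w}.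
Proof.
move=> p0; apply: ae_foralln => j0.
pose N := \bigcap_M no_block j0 M.
have mN : measurable N by apply: bigcapT_measurable => M; exact: measurable_no_block.
exists N; split=> //.
  have le_N M : (P N <= ((1 - p ^+ m) ^+ M)%:E)%E.
    apply: le_trans (_ : P (no_block j0 M) <= _)%E.
      by apply: le_measure; rewrite ?inE //; [exact: measurable_no_block|exact: bigcap_inf].
    have := @probability_no_block j0 M [::] isT isT (fun _ _ _ _ => isT).
    have -> : no_block j0 M `&` all_in [::] = no_block j0 M.
      by apply/seteqP; split=> [w []//|w Nw]; split.
    by rewrite expr0 mulr1 => ->.
  have p1 : p <= 1 by rewrite -lee_fin -LIE probability_le1.
  have q01 : `|1 - p ^+ m| < 1.
    have := exprn_gt0 m p0; have := exprn_ile1 m (ltW p0) p1 => q1 q0.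
    by rewrite ltr_norml; apply/andP; split; lra.
  have PNfin : P N \is a fin_num by rewrite fin_num_measure.
  apply: (etrans (esym (fineK PNfin))); congr EFin; apply/eqP.
  rewrite eq_le fine_ge0 ?measure_ge0 // andbT.
  apply: (cvgr_to_ge (cvg_expr q01)).
  by apply: nearW => M; rewrite -lee_fin fineK.
move=> w; apply: contra_notP => /existsNP[M]; rewrite /no_block /=.
move=> /not_implyP[_] /existsNP[j /not_implyP[/andP[jl _] /contrapT wj]].
by exists j.
Qed.

(** The number of good blocks among the first [M], divided by the size of the
    smallest matrix that contains these [M] blocks. *)
Definition block_freq (M : nat) (w : T) : R :=
  (M * m.+1).+1%:R^-1 * \sum_(j < M) \1_(all_in (block j)) w.

Lemma block_freq_ge0 M w : 0 <= block_freq M w.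
Proof. by rewrite mulr_ge0 ?invr_ge0 ?sumr_ge0 // => j _. Qed.

Lemma block_freq_le1 M w : block_freq M w <= 1.
Proof.
rewrite /block_freq mulrC ler_pdivrMr ?ltr0n // mul1r.
apply: (@le_trans _ _ (\sum_(j < M) 1)).
  by apply: ler_sum => j _; rewrite indicE; case: (_ \in _).
rewrite sumr_const card_ord ler_nat; nia.
Qed.

Lemma measurable_block_freq M : measurable_fun setT (EFin \o block_freq M).
Proof.
apply/measurable_EFinP; apply: measurable_funM => //.
by apply: measurable_sum => j; apply: measurable_indic; exact: measurable_all_in.
Qed.

Lemma integral_block_freq M :
  (\int[P]_w (block_freq M w)%:E = ((M * m.+1).+1%:R^-1 * (M%:R * p ^+ m))%:E)%E.
Proof.
under eq_integral do rewrite /block_freq EFinM.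
rewrite ge0_integralZl_EFin ?invr_ge0 //; last 2 first.
- by move=> w _; rewrite lee_fin sumr_ge0.
- apply/measurable_EFinP.
  by apply: measurable_sum => j; apply: measurable_indic; exact: measurable_all_in.
under eq_integral do rewrite -sumEFin.
rewrite ge0_integral_sum //; last first.
  by move=> j; apply/measurable_EFinP; apply: measurable_indic; exact: measurable_all_in.
have e j : (\int[P]_x (\1_(all_in (block j)) x)%:E = (p ^+ m)%:E)%E.
  rewrite integral_indic //; last exact: measurable_all_in.
  by rewrite setIT; exact: probability_all_in_block.
rewrite (eq_bigr (fun=> (p ^+ m)%:E)) => [|j _]; last exact: e.
by rewrite sumEFin sumr_const card_ord -EFinM mulr_natl.
Qed.

(** Almost sure convergence to 0 would give convergence of the means by dominated
    convergence, while these are at least p^m / (m + 2) for M >= 1. *)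
Lemma block_freq_Ncvg0 : 0 < p ->
  ~ {ae P, forall w, block_freq ^~ w @ \oo --> 0}.
Proof.
move=> p0 fcvg.
have [] := @dominated_convergence _ _ _ P setT measurableT
  (fun M => EFin \o block_freq M) (cst 0%E) (cst 1%E).
- exact: measurable_block_freq.
- exact: measurable_cst.
- by apply: filterS fcvg => w fw _; apply: cvg_EFin => //; apply: nearW.
- by apply: finite_measure_integrable_cst.
- by apply: aeW => w M _; rewrite /= lee_fin ger0_norm ?block_freq_ge0 ?block_freq_le1.
move=> _ _; rewrite integral0 => icvg.
have {}icvg : (fun M => (M * m.+1).+1%:R^-1 * (M%:R * p ^+ m)) @ \oo --> (0 : R).
  have ecvg : (fun M => ((M * m.+1).+1%:R^-1 * (M%:R * p ^+ m))%:E) @ \oo --> 0%:E.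
    apply: cvg_trans icvg; apply: near_eq_cvg.
    by apply: nearW => M; rewrite /= integral_block_freq.
  exact: (fine_cvg ecvg).
have : m.+2%:R^-1 * p ^+ m <= 0.
  apply: (cvgr_to_ge icvg); exists 1%N => // M /= M1.
  rewrite mulrA ler_wpM2r ?exprn_ge0 ?(ltW p0) //.
  rewrite mulrC ler_pdivlMr ?ltr0n // mulrC ler_pdivrMr ?ltr0n //.
  rewrite -natrM ler_nat; nia.
by apply/negP; rewrite -ltNge mulr_gt0 ?invr_gt0 ?ltr0n ?exprn_gt0.
Qed.

End Events.

(** * Consequences for a fixed environment *)

Section GapBound.
Variables (R : realType) (v : nat -> R) (t : R).
Hypothesis v01 : forall p, (2 <= p)%N -> 0 <= v p <= 1.
Hypothesis vt : (0 < t < 1 / 2 /\ (forall p, (2 <= p)%N -> v p <= t)) \/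
  (1 / 2 < t < 1 /\ (forall p, (2 <= p)%N -> t <= v p)).

Lemma gap_bound_ge0 : 0 <= gap_bound t.
Proof. by rewrite /gap_bound; case: vt => -[/andP[t0 t1] _]; nra. Qed.

Lemma gap_bound_lt1 : gap_bound t < 1.
Proof. by rewrite /gap_bound; case: vt => -[/andP[t0 t1] _]; nra. Qed.

Lemma eigval2_le_gap n : eigval (bd_kernel v n) 2 <= gap_bound t.
Proof.
have [n2|n2] := leqP 2 n; last first.
  by rewrite /eigval nth_default ?gap_bound_ge0 // size_spectrum.
rewrite eigval2_sym // lerNl; have [ss _ _] := bd_spectrumP v01 n.
apply: nth_ge_count => //; apply: leq_trans (count_ge_gap v01 n vt).
by case: (n) n2 => [|[]].
Qed.

(** At most one eigenvalue is below [- gap_bound t], hence by symmetry at most one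
    is above [gap_bound t]. *)
Lemma count_out_gap n :
  (count (fun y => ~~ (`|y| <= gap_bound t)%R) (spectrum (bd_kernel v n)) <= 2)%N.
Proof.
set s := spectrum _; set g := gap_bound t.
have low : (count (fun y => (y < - g)%R) s <= 1)%N.
  have := count_predC (fun y => (- g <= y)%R) s.
  rewrite size_spectrum //; have := count_ge_gap v01 n vt; rewrite -/s -/g.
  rewrite (eq_count (a1 := predC _) (a2 := fun y => (y < - g)%R)) => [|y];
    last by rewrite /= ltNge.
  by move=> h1 h2; lia.
have high : (count (fun y => (g < y)%R) s <= 1)%N.
  rewrite /s (spectrum_rev_opp v01 n) count_rev count_map; apply: leq_trans low.
  by rewrite (eq_count (a2 := fun y => (y < - g)%R)) // => y /=; rewrite ltrNr.
apply: (@leq_trans (count (fun y => (y < - g)%R) s + count (fun y => (g < y)%R) s)).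
  rewrite -count_predUI; apply: leq_trans (leq_addr _ _); apply: sub_count => y /=.
  by rewrite ler_norml negb_and -!ltNge.
exact: leq_add low high.
Qed.

End GapBound.

Lemma ae_exists (R : realType) (d : measure_display) (T : measurableType d)
    (P : probability T R) (Q : T -> Prop) : {ae P, forall w, Q w} -> exists w, Q w.
Proof.
move=> [N [mN PN0 sub]]; apply: contrapT => nQ.
have NT : N = setT.
  by apply/seteqP; split=> // w _; apply: sub => /= Qw; apply: nQ; exists w.
by have := probability_setT P; rewrite -NT PN0 => /esym/eqP; rewrite onee_eq0.
Qed.

Lemma limn_esup_le (R : realType) (u : nat -> \bar R) (l : \bar R) :
  (forall n, u n <= l)%E -> (limn_esup u <= l)%E.
Proof.
move=> ul; apply: (@le_trans _ _ (ereal_sup (u @` setT))).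
  apply: ereal_inf_lbound => /=; exists setT => //; exact: filterT.
by apply: ge_ereal_sup => _ [n _ <-].
Qed.

(** Room for a run length [m] and a tolerance [e] below the threshold [t0] for
    which the Rayleigh quotient (1 - 2e)(1 - 1/m) is within [eps] of 1. *)
Lemma block_parameters (R : realType) (eps t0 : R) : 0 < eps -> 0 < t0 ->
  exists m, exists e : R, [/\ (0 < m)%N, 0 < e < t0, e <= 2^-1 &
    1 - eps <= (1 - 2 * e) * (1 - m%:R^-1)].
Proof.
move=> eps0 t00; pose m := (Num.truncn (2 / eps)).+1.
exists m, (Num.min (t0 / 2) (Num.min (eps / 4) 4^-1)).
set e := Num.min _ _.
have e1 : e <= t0 / 2 by rewrite ge_min lexx.
have e2 : e <= eps / 4 by rewrite !ge_min lexx orbT.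
have e3 : e <= 4^-1 by rewrite !ge_min lexx !orbT.
have e0 : 0 < e by rewrite !lt_min !divr_gt0 //= invr_gt0 ltr0n.
have mi : m%:R^-1 <= eps / 2.
  rewrite -[leRHS]invrK lef_pV2 ?posrE ?invr_gt0 ?divr_gt0 ?ltr0n //.
  by rewrite invf_div ltW // truncnS_gt.
have m0 : 0 <= (m%:R : R)^-1 by rewrite invr_ge0.
clearbody e; split=> //; [by apply/andP; split; lra|by lra|].
have := mulr_ge0 (ltW e0) m0; lra.
Qed.

Section BlocksAtHalf.
Context (R : realType) (d : measure_display) (T : measurableType d)
  (P : probability T R) (V : nat -> {RV P >-> R}).

Definition near_half (e : R) : set (measurableTypeR R) :=
  [set` `[(1 / 2 - e)%R, (1 / 2 + e)%R]].

Lemma count_all_in_blocks (m n : nat) (e : R) (w : T) (bs : seq nat) :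
  (forall p, (2 <= p)%N -> 0 <= V p w <= 1) -> (0 < m)%N -> e <= 2^-1 ->
  uniq bs ->
  (forall j, j \in bs -> (j.+1 * m.+1 < n)%N) ->
  (forall j, j \in bs -> all_in V (near_half e) (block m j) w) ->
  (size bs <= count (fun x => ((1 - 2 * e) * (1 - m%:R^-1) <= x)%R)
     (spectrum (bd_kernel (fun i => V i w) n)))%N.
Proof.
move=> v01 m0 e2 ubs bsn good; apply: count_near_half_runs => // j k jb km.
have := good j jb (j * m.+1 + k).+2; rewrite /near_half /= in_itv /= div1r; apply.
by apply/blockP; exists k.
Qed.

End BlocksAtHalf.

(** * The random environment *)

Section Environment.
Context (R : realType) (d : measure_display) (T : measurableType d)
  (P : probability T R) (L : probability (measurableTypeR R) R)
  (V : nat -> {RV P >-> R}).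
Hypothesis L01 : L [set` `[0, 1]] = 1%E.
Hypothesis V_law : forall i : nat, (2 <= i)%N -> has_law (V i) L.
Hypothesis V_indep : mutually_independent [set i | (2 <= i)%N] V.

Lemma ae_V01 : {ae P, forall w, forall p, (2 <= p)%N -> 0 <= V p w <= 1}.
Proof.
have := ae_law V_law (measurable_itv _) L01.
by apply: filterS => w h p p2; have := h p p2; rewrite /= in_itv.
Qed.

Lemma near_half_gt0 : positive_density_at_half L ->
  exists2 t0 : R, 0 < t0 & forall e, 0 < e < t0 -> 0 < fine (L (near_half e)).
Proof.
move=> [C [t0 [C0 /andP[t00 _] CL]]]; exists t0 => // e e0t0.
apply: fine_gt0; apply/andP; split; last first.
  by apply: le_lt_trans (probability_le1 _ _) (ltry _); exact: measurable_itv.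
apply: lt_le_trans (CL e e0t0); rewrite lte_fin mulr_gt0 //.
by case/andP: e0t0.
Qed.

Section PositiveDensity.
Hypothesis half : positive_density_at_half L.

(** Two good blocks suffice, and they sit in every sufficiently large matrix. *)
Lemma ae_eigval2_ge eps : 0 < eps -> {ae P, forall w,
  \forall n \near \oo, 1 - eps <= eigval (bd_kernel (fun i => V i w) n) 2}.
Proof.
move=> eps0; have [t0 t00 Lpos] := near_half_gt0 half.
have [m [e [m0 e0 e2 epsP]]] := block_parameters eps0 t00.
have mI : measurable (near_half e) by exact: measurable_itv.
have := ae_frequently_block V_law V_indep mI m0 (Lpos e e0).
apply: filterS2 ae_V01 => w v01 freq.
have [j1 _ good1] := freq 0%N; have [j2 j12 good2] := freq j1.+1.
exists (j2.+1 * m.+1).+1 => // n /= jn.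
have [ss _ _] := bd_spectrumP v01 n.
apply: (le_trans epsP); apply: nth_ge_count => //.
apply: (@count_all_in_blocks _ _ _ _ _ m n e w [:: j1; j2]) => //.
- by rewrite /= inE (ltn_eqF j12).
- move=> j; rewrite !inE => /orP[]/eqP->; apply: leq_ltn_trans jn; rewrite leq_mul //.
  by rewrite ltnS ltnW.
- by move=> j; rewrite !inE => /orP[]/eqP->.
Qed.

Lemma ae_eigval2_cvg_1 : {ae P, forall w,
  (fun n => eigval (bd_kernel (fun i => V i w) n) 2) @ \oo --> (1 : R)}.
Proof.
have : {ae P, forall w, forall k : nat, \forall n \near \oo,
    1 - k.+1%:R^-1 <= eigval (bd_kernel (fun i => V i w) n) 2}.
  by apply: ae_foralln => k; apply: ae_eigval2_ge; rewrite invr_gt0.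
apply: filterS2 ae_V01 => w v01 lam_ge.
apply/cvgrPdist_le => eps eps0.
have k_eps : (Num.truncn eps^-1).+1%:R^-1 <= eps.
  by rewrite -[leRHS]invrK lef_pV2 ?posrE ?invr_gt0 ?ltr0n // ltW // truncnS_gt.
apply: filterS (lam_ge (Num.truncn eps^-1)) => n lam_n.
have := eigval_le1 v01 n 2; rewrite ler_norml => /andP[_ lam1].
rewrite ger0_norm ?subr_ge0 // lerBlDl -lerBlDr; apply: le_trans lam_n.
by rewrite lerD2l lerN2.
Qed.

(** Were the integral of a bump at 1 zero, the averages of this bump would tend to
    0; they dominate half of [block_freq], because each good block supplies an
    eigenvalue near 1. *)
Lemma msupport1 mu : limiting_spectral_distribution V mu -> msupport mu 1.
Proof.
move=> lsd; apply/msupport_bumpP => x x0.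
rewrite lt_neqAle Rintegral_ge0 => [|y _]; last exact: bump_ge0.
rewrite andbT eq_sym; apply/negP => /eqP I0.
have x2 : 0 < x / 2 by rewrite divr_gt0.
have [t0 t00 Lpos] := near_half_gt0 half.
have [m [e [m0 e0 e2 epsP]]] := block_parameters x2 t00.
have mI : measurable (near_half e) by exact: measurable_itv.
apply: (block_freq_Ncvg0 V_law V_indep mI m0 (Lpos e e0)).
apply: filterS2 ae_V01 lsd => w v01 wc.
set K := bd_kernel (fun i => V i w) in wc.
have sub : (fun M => (M * m.+1).+1%:R^-1 *
     \sum_(y <- spectrum (K (M * m.+1).+1)) bump 1 x y) @ \oo --> (0 : R).
  have := cvg_bump v01 wc (x := 1) x0; rewrite I0 => cv.
  apply: (cvg_comp (fun M => (M * m.+1).+1) _ _ cv).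
  by move=> A [N _ NA]; exists N => // M /= NM; apply: NA => /=; nia.
apply: (@squeeze_cvgr _ _ _ _ (cst 0) (fun M => 2 * ((M * m.+1).+1%:R^-1 *
     \sum_(y <- spectrum (K (M * m.+1).+1)) bump 1 x y))); last 2 first.
- exact: cvg_cst.
- have := @cvgMl_tmp _ _ _ _ _ 2 _ sub; rewrite mulr0; exact.
apply: nearW => M; rewrite block_freq_ge0 /=.
set n := (M * m.+1).+1.
have := count_le_avg_bump v01 n x0; rewrite -/K -ler_pdivlMl ?invr_gt0 // invrK => h.
apply: le_trans h; rewrite /block_freq -/n mulrC ler_wpM2r ?invr_ge0 //.
pose good j := `[< all_in V (near_half e) (block m j) w >].
apply: (@le_trans _ _ (size [seq j <- iota 0 M | good j])%:R).
  rewrite size_filter -sum1_count natr_sum [leRHS]big_mkcond /=.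
  rewrite -(big_mkord xpredT (fun j => \1_(all_in V (near_half e) (block m j)) w)).
  rewrite /index_iota subn0; apply: ler_sum => j _; rewrite indicE /good.
  by case: asboolP => [wj|wj]; [rewrite mem_set|rewrite memNset].
rewrite ler_nat.
apply: leq_trans (_ : _ <= count
  (fun x => ((1 - 2 * e) * (1 - m%:R^-1) <= x)%R) (spectrum (K n)))%N _;
  last by apply: sub_count => y /=; apply: le_trans.
apply: count_all_in_blocks => //.
- by rewrite filter_uniq // iota_uniq.
- by move=> j; rewrite mem_filter mem_iota => /andP[_ /andP[_ jM]]; rewrite /n; nia.
- by move=> j; rewrite mem_filter => /andP[/asboolP].
Qed.

Lemma is_edge1 mu : limiting_spectral_distribution V mu -> is_edge mu 1.
Proof.
move=> lsd; have S1 := msupport1 lsd.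
have [w [v01 wc]] := ae_exists (filterI ae_V01 lsd).
have [|alpha [edge alpha1 _]] := @is_edge_exists _ mu 1 _ (msupportN v01 wc).
  apply: (msupport_sub_itv v01 wc) => n.
  rewrite (_ : count _ _ = 0%N) //; apply/eqP; rewrite -leqn0 leqNgt -has_count.
  by apply/hasPn => y /(spectrum_le1 v01) ->.
suff <- : alpha = 1 by [].
have : convex_hull (msupport mu) 1 by apply: sub_gen_smallest.
by rewrite edge /= in_itv /= => /andP[_ ?]; apply/le_anti/andP.
Qed.

End PositiveDensity.

Section Gap.
Variable t : R.
Hypothesis Lt :
  ((0 < t < 1 / 2) /\ L [set` `[0, t]] = 1%E) \/
  ((1 / 2 < t < 1) /\ L [set` `[t, 1]] = 1%E).

Lemma ae_gap : {ae P, forall w,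
  (0 < t < 1 / 2 /\ (forall p, (2 <= p)%N -> V p w <= t)) \/
  (1 / 2 < t < 1 /\ (forall p, (2 <= p)%N -> t <= V p w))}.
Proof.
case: Lt => -[t01 Lt1].
  apply: filterS (ae_law V_law (measurable_itv _) Lt1) => w h; left; split=> // p p2.
  by have := h p p2; rewrite /= in_itv => /andP[].
apply: filterS (ae_law V_law (measurable_itv _) Lt1) => w h; right; split=> // p p2.
by have := h p p2; rewrite /= in_itv => /andP[].
Qed.

Lemma ae_limn_esup_lt1 : {ae P, forall w,
  (limn_esup (fun n => (eigval (bd_kernel (fun i => V i w) n) 2)%:E) < 1)%E}.
Proof.
apply: filterS2 ae_V01 ae_gap => w v01 vt.
apply: (@le_lt_trans _ _ (gap_bound t)%:E); last by rewrite lte_fin (gap_bound_lt1 vt).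
by apply: limn_esup_le => n; rewrite lee_fin (eigval2_le_gap v01 vt).
Qed.

Lemma is_edge_lt1 mu : limiting_spectral_distribution V mu ->
  exists2 alpha : R, is_edge mu alpha & alpha < 1.
Proof.
move=> lsd; have [w [[v01 vt] wc]] := ae_exists (filterI (filterI ae_V01 ae_gap) lsd).
have [|alpha [edge alpha_le _]] := @is_edge_exists _ mu (gap_bound t) _ (msupportN v01 wc).
  by apply: (msupport_sub_itv v01 wc) => n; exact: count_out_gap.
by exists alpha => //; apply: le_lt_trans alpha_le (gap_bound_lt1 vt).
Qed.

End Gap.
End Environment.

Theorem theorem1p10 (R : realType) (d : measure_display)
    (T : measurableType d) (P : probability T R)
    (L : probability (measurableTypeR R) R)
    (V : nat -> {RV P >-> R})
    (L01 : L [set` `[0, 1]] = 1%E)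
    (V_law : forall i : nat, (2 <= i)%N -> has_law (V i) L)
    (V_indep : mutually_independent [set i | (2 <= i)%N] V) :
  let K (n : nat) (w : T) : 'M[R]_n := bd_kernel (fun i => V i w) n in
  (positive_density_at_half L ->
     (forall mu : probability (measurableTypeR R) R,
        limiting_spectral_distribution V mu -> is_edge mu 1) /\
     {ae P, forall w,
        (forall n : nat, (2 <= n)%N ->
           eigval (K n w) 2 = - eigval (K n w) n.-1) /\
        (fun n => eigval (K n w) 2) @ \oo --> (1 : R)})
  /\
  (forall t : R,
     ((0 < t < 1 / 2) /\ L [set` `[0, t]] = 1%E) \/
     ((1 / 2 < t < 1) /\ L [set` `[t, 1]] = 1%E) ->
     {ae P, forall w, (limn_esup (fun n => (eigval (K n w) 2)%:E) < 1)%E} /\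
     (forall mu : probability (measurableTypeR R) R,
        limiting_spectral_distribution V mu ->
        exists2 alpha : R, is_edge mu alpha & alpha < 1)).
Proof.
split=> [half|t Lt]; split.
- by move=> mu; exact: (is_edge1 L01 V_law V_indep half).
- have c := ae_eigval2_cvg_1 L01 V_law V_indep half.
  apply: filterS2 (ae_V01 L01 V_law) c => w v01 cw; split=> // n n2.
  exact: eigval2_sym.
- exact: (ae_limn_esup_lt1 L01 V_law Lt).
- by move=> mu; exact: (is_edge_lt1 L01 V_law Lt).
Qed.
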